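(* If $k$ and $n$ are integers satisfying $1 \leq k \leq n$, then $$\nu(G(n,k)) \geq \nu(St(n,k)) \geq n-k,$$ where $\nu$ denotes the Yang index, $St(n,k)$ carries the involution $S$ negating the last vector of each frame, and $G(n,k)$ carries the involution $T$ reversing the orientation of each $k$-plane.
   Context: All homology is with $\mathbb{Z}_2$ coefficients. Stiefel manifold and Grassmannian. $St(n,k)=\{(v_1,\ldots,v_k) : v_i\in\mathbb{R}^n,\ v_i\cdot v_j=\delta_{i,j}\}$, with the free involution $S(v_1,\ldots,v_k)=(v_1,\ldots,v_{k-1},-v_k)$. $G(n,k)=St(n,k)/SO(k)$ (right action) is the Grassmannian of oriented $k$-planes through the origin in $\mathbb{R}^n$, with the free involution $T$ reversing the orientation of each $k$-plane. Yang index. A $T$-space is a pair $(X,T)$ with $X$ a compact Hausdorff space and $T$ a fixed-point free involution of $X$. It is simplicial if $X$ is a finite simplicial complex whose simplices are permuted by $T$. For simplicial $(X,T)$, an $m$-chain $c$ is $T$-invariant if $T(c)=c$, equivalently $c=d+T(d)$ for some $m$-chain $d$. Let $C_m(X,T)$ be the group of $T$-invariant $m$-chains; $\partial$ restricts to these, and $H_m(X,T)=Z_m(X,T)/B_m(X,T)$, where $Z_m(X,T)$ is the kernel of $\partial_m$ on $C_m(X,T)$ and $B_m(X,T)$ is the image of $C_{m+1}(X,T)$ under $\partial_{m+1}$. For $c=d+T(d)\in Z_0(X,T)$, the index $\nu(c)\in\mathbb{Z}_2$ is the parity of the number of vertices in $d$; for $c=d+T(d)\in Z_m(X,T)$ with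 $m\ge 1$, $\nu(c)=\nu(\partial d)$, inductively. This is independent of choices and gives a homomorphism $\nu:H_m(X,T)\to\mathbb{Z}_2$. For an arbitrary $T$-space, $H_m(X,T)$ and $\nu$ are defined in the Čech manner, i.e. as the inverse limit over the nerves of finite $T$-invariant open covers all of whose members $U$ satisfy $U\cap T(U)=\emptyset$ ($H_m(X,T)$ is isomorphic to the $m$-th Čech homology group of $X/T$). The Yang index $\nu(X,T)$ is the largest integer $m$ such that $\nu(H_m(X,T))\neq\{0\}$. The involution is suppressed in the notation for $St(n,k)$ and $G(n,k)$. *)

(* Defs.v *)
From HB Require Import structures.
From mathcomp Require Import all_boot all_order all_algebra.
From mathcomp Require Import generic_quotient ring_quotient perm ring.
Set Implicit Arguments.
Unset Strict Implicit.
Unset Printing Implicit Defensive.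
Import Order.TTheory GRing.Theory Num.Theory.

Local Open Scope ring_scope.

Notation chain V := {ffun {set V} -> 'F_2}.

(* The value at set0 is 0, so the boundary of a 0-chain vanishes: homology is
   not augmented. *)
Definition bd (V : finType) (c : chain V) : chain V :=
  [ffun s : {set V} => if s == set0 then 0 else \sum_(v | v \notin s) c (v |: s)].

(* Simplices whose dimension drops under f are sent to 0. *)
Definition push (V W : finType) (f : V -> W) (c : chain V) : chain W :=
  [ffun s : {set W} => \sum_(r : {set V} | (f @: r == s) && (#|r| == #|s|)) c r].

(* Elements of V that are not in any simplex are allowed; the vertices are the
   v with [set v] \in simplices. The last field says that the induced map of the
   geometric realization has no fixed point: a simplex mapped onto itself would
   have a fixed barycenter. *)
Record Tcomplex (V : finType) := TComplex {
  simplices : {set {set V}};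
  vinv : V -> V;
  simplices_neq0 : forall s, s \in simplices -> s != set0;
  simplices_sub : forall s r : {set V},
    s \in simplices -> r \subset s -> r != set0 -> r \in simplices;
  vinvK : involutive vinv;
  vinv_simplices : forall s, s \in simplices -> vinv @: s \in simplices;
  vinv_free : forall s, s \in simplices -> vinv @: s != s }.

Section InvariantHomology.
Variables (V : finType) (K : Tcomplex V).

Definition chains (m : nat) : {pred chain V} :=
  [pred c : chain V | [forall s : {set V},
     (c s != 0) ==> (s \in simplices K) && (#|s| == m.+1)]].

Definition inv_chains (m : nat) : {pred chain V} :=
  [pred c | (c \in chains m) && (push (vinv K) c == c)].

Definition inv_cycles (m : nat) : {pred chain V} :=
  [pred c | (c \in inv_chains m) && (bd c == 0)].

Lemma bdB (c d : chain V) : bd (c - d) = bd c - bd d.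
Proof.
apply/ffunP => s; rewrite !ffunE; case: ifP => _; first by rewrite subr0.
by rewrite -sumrB; apply: eq_bigr => v _; rewrite !ffunE.
Qed.

Lemma pushB (W : finType) (f : V -> W) (c d : chain V) :
  push f (c - d) = push f c - push f d.
Proof.
by apply/ffunP => s; rewrite !ffunE -sumrB; apply: eq_bigr => v _; rewrite !ffunE.
Qed.

Lemma push0 (W : finType) (f : V -> W) : push f 0 = 0.
Proof. by rewrite -(subrr 0) pushB !subrr. Qed.

Lemma chains_zmod m : zmod_closed (chains m).
Proof.
split=> [|c d /forallP cP /forallP dP]; first by apply/forallP => s; rewrite ffunE eqxx.
apply/forallP => s; apply/implyP; rewrite !ffunE => cd0.
have [c0|/(implyP (cP s))//] := eqVneq (c s) 0.
by apply: (implyP (dP s)); apply: contraNneq cd0 => ->; rewrite c0 subr0.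
Qed.

Lemma inv_chains_zmod m : zmod_closed (inv_chains m).
Proof.
have [C0 CB] := chains_zmod m.
split=> [|c d /andP[cC /eqP ce] /andP[dC /eqP de]].
  by apply/andP; rewrite push0 eqxx.
by apply/andP; split; [exact: CB | rewrite pushB ce de].
Qed.

Lemma inv_cycles_zmod m : zmod_closed (inv_cycles m).
Proof.
have [C0 CB] := inv_chains_zmod m.
split=> [|c d /andP[cC /eqP ce] /andP[dC /eqP de]].
  by apply/andP; split => //; rewrite -[X in bd X](subrr 0) bdB subrr.
by apply/andP; split; [exact: CB | rewrite bdB ce de subrr].
Qed.

HB.instance Definition _ m :=
  GRing.isZmodClosed.Build (chain V) (inv_cycles m) (inv_cycles_zmod m).

Record Tcycle (m : nat) :=
  TCycle { Tcycle_chain :> chain V; _ : Tcycle_chain \in inv_cycles m }.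

HB.instance Definition _ m := [isSub for @Tcycle_chain m].
HB.instance Definition _ m := [Choice of Tcycle m by <:].
HB.instance Definition _ m := [SubChoice_isSubZmodule of Tcycle m by <:].

Definition inv_boundaries (m : nat) : {pred Tcycle m} :=
  [pred c : Tcycle m | [exists e : chain V,
     (e \in inv_chains m.+1) && (bd e == c)]].

Lemma inv_boundaries_zmod m : zmod_closed (@inv_boundaries m).
Proof.
have [C0 CB] := inv_chains_zmod m.+1.
split=> [|c d /existsP[a /andP[aC /eqP ac]] /existsP[b /andP[bC /eqP bE]]].
  by apply/existsP; exists 0; rewrite C0/= -[X in bd X](subrr 0) bdB subrr.
apply/existsP; exists (a - b); rewrite CB//= bdB ac bE.
exact/eqP/esym/(raddfB (val : Tcycle m -> chain V)).
Qed.

HB.instance Definition _ m :=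
  GRing.isZmodClosed.Build (Tcycle m) (@inv_boundaries m) (inv_boundaries_zmod m).

Definition THomology (m : nat) : zmodType :=
  Quotient.quot (@inv_boundaries m : zmodClosed (Tcycle m)).

(* c = d + T d for the chosen d; the value on invariant cycles depends neither on
   the choice of d nor on the homology class. The default 0 is used only when
   no such d exists, which does not happen for invariant chains. *)
Fixpoint chain_index (m : nat) (c : chain V) : 'F_2 :=
  let d := odflt 0 [pick d in chains m | c == d + push (vinv K) d] in
  if m is m'.+1 then chain_index m' (bd d) else \sum_(s : {set V}) d s.

Definition homology_index (m : nat) (x : THomology m) : 'F_2 :=
  chain_index m (Tcycle_chain (repr x)).

End InvariantHomology.

Lemma push_comp (U V W : finType) (f : U -> V) (g : V -> W) (c : chain U) :
  push g (push f c) = push (g \o f) c.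
Proof.
apply/ffunP => s; rewrite !ffunE.
rewrite [RHS](partition_big (fun q : {set U} => f @: q)
  (fun r : {set V} => (g @: r == s) && (#|r| == #|s|)))/=; last first.
  move=> q /andP[/eqP <- /eqP qs]; rewrite imset_comp eqxx/= eqn_leq.
  rewrite leq_imset_card andbT -imset_comp -qs.
  exact: leq_imset_card.
apply: eq_bigr => r /andP[/eqP rs /eqP rE]; rewrite ffunE; apply: eq_bigl => q.
rewrite imset_comp; apply/andP/andP => [[/eqP qr qE]|[/andP[_ qE] qr]].
  by rewrite qr rs eqxx -rE qE.
by rewrite qr rE.
Qed.

Lemma eq_push (V W : finType) (K : Tcomplex V) (f g : V -> W) m (c : chain V) :
  (forall v, [set v] \in simplices K -> f v = g v) ->
  c \in chains K m -> push f c = push g c.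
Proof.
move=> fg /forallP cP; apply/ffunP => s; rewrite !ffunE big_mkcond [RHS]big_mkcond/=.
apply: eq_bigr => r _; have [->|cr] := eqVneq (c r) 0; first by rewrite !if_same.
have /andP[rK _] := implyP (cP r) cr; congr (if (_ == _) && _ then _ else _).
apply: eq_in_imset => v vr; apply: fg; apply: simplices_sub rK _ _.
  by rewrite sub1set.
by apply/set0Pn; exists v; rewrite inE.
Qed.

Lemma F2_mulrn_odd (x : 'F_2) (p q : nat) : odd p = odd q -> x *+ p = x *+ q.
Proof.
have x2 : x *+ 2 = 0 by rewrite -mulr_natr pchar_Fp_0// mulr0.
have xo k : x *+ k = x *+ odd k.
  by rewrite -[in LHS](odd_double_half k) mulrnDr -mul2n mulrnA x2 mul0rn addr0.
by move=> pq; rewrite xo pq -xo.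
Qed.

Lemma odd_faces (V W : finType) (f : V -> W) (r : {set V}) (s : {set W}) :
  #|r| = #|s|.+1 ->
  odd #|[set w | (w \notin s) && (f @: r == w |: s)]| =
  odd #|[set v in r | f @: (r :\ v) == s]|.
Proof.
move=> rs; set A := [set w | _]; set B := [set v | _ & _].
have fD v : v \in r -> f @: r = f v |: f @: (r :\ v).
  by move=> vr; rewrite -imsetU1 setD1K.
have [fr|fr] := eqVneq #|f @: r| #|r|.
  have fi : {in r &, injective f} by apply/imset_injP; rewrite fr.
  have -> : A = f @: B.
    apply/setP => w; apply/idP/imsetP => [|[v]].
      rewrite inE => /andP[ws /eqP frw].
      have /imsetP[v vr wE] : w \in f @: r by rewrite frw setU11.
      exists v => //; rewrite inE vr/= eqEcard; apply/andP; split.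
        apply/subsetP => w' /imsetP[u]; rewrite !inE => /andP[uv ur] ->.
        have : f u \in f @: r by apply: imset_f.
        rewrite frw !inE => /orP[/eqP|//]; rewrite wE => /fi uE.
        by rewrite uE ?eqxx// in uv.
      rewrite card_in_imset; last first.
        by move=> x y; rewrite !inE => /andP[_ xr] /andP[_ yr]; apply: fi.
      by have := cardsD1 v r; rewrite vr rs add1n => -[->].
    rewrite inE => /andP[vr /eqP frv] ->; rewrite inE (fD v vr) frv eqxx andbT.
    apply/negP => fvs; have := fr; rewrite (fD v vr) frv rs.
    by rewrite (setUidPr _) ?sub1set// => /eqP; rewrite -[X in X == _]addn0 -addn1 eqn_add2l.
  rewrite card_in_imset// => x y; rewrite !inE => /andP[xr _] /andP[yr _].
  exact: fi.
have -> : A = set0.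
  apply/setP => w; rewrite !inE; apply/negP => /andP[ws /eqP frw].
  by move/eqP: fr; rewrite frw cardsU1 ws rs.
rewrite cards0; have [->|/set0Pn[v1]] := eqVneq B set0; first by rewrite cards0.
have Bi v : v \in B -> {in r :\ v &, injective f}.
  rewrite inE => /andP[vr /eqP frv]; apply/imset_injP; rewrite frv.
  by have := cardsD1 v r; rewrite vr rs add1n => -[->].
move=> v1B; have := v1B; rewrite inE => /andP[v1r /eqP fv1].
have fv1s : f v1 \in s.
  apply: contraNT fr => fv1s.
  by rewrite (fD _ v1r) fv1 cardsU1 fv1s rs.
have frs : f @: r = s by rewrite (fD _ v1r) fv1; apply/setUidPr; rewrite sub1set.
have := fv1s; rewrite -[in X in X -> _]fv1 => /imsetP[v2]; rewrite 2!inE => /andP[v21 v2r] f12.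
suff -> : B = [set v1; v2] by rewrite cards2 eq_sym v21.
apply/setP => v; rewrite [RHS]inE !in_set1; apply/idP/orP => [vB|[/eqP->//|/eqP->]].
  have [?|vv1] := eqVneq v v1; first by left.
  have [?|vv2] := eqVneq v v2; first by right.
  have := @Bi v vB v1 v2; rewrite !inE v1r v2r eq_sym vv1 eq_sym vv2 => /(_ isT isT f12) E.
  by rewrite E eqxx in v21.
rewrite inE v2r/= -frs eqEsubset imsetS ?subsetDl//=.
apply/subsetP => _ /imsetP[u ur ->].
have [->|uv2] := eqVneq u v2.
  by rewrite -f12; apply: imset_f; rewrite !inE eq_sym v21.
by apply: imset_f; rewrite !inE uv2.
Qed.

Lemma bd_push (V W : finType) (f : V -> W) (c : chain V) :
  bd (push f c) = push f (bd c).
Proof.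
apply/ffunP => s; rewrite !ffunE; case: ifPn => [/eqP->|s0].
  rewrite big1// => r /andP[_]; rewrite cards0 cards_eq0 => /eqP->.
  by rewrite ffunE eqxx.
have qE (q : {set V}) : (f @: q == s) && (#|q| == #|s|) ->
    bd c q = \sum_(v | v \notin q) c (v |: q).
  move=> /andP[_ /eqP qs]; rewrite ffunE ifN// -card_gt0 qs card_gt0//.
rewrite (eq_bigr _ qE).
rewrite [LHS](eq_bigr (fun w => \sum_(r : {set V} |
    (f @: r == w |: s) && (#|r| == #|w |: s|)) c r)); last first.
  by move=> w _; rewrite ffunE.
rewrite (exchange_big_dep xpredT)//= [RHS](exchange_big_dep xpredT)//=.
have -> : \sum_(v : V) \sum_(q : {set V} | ((f @: q == s) && (#|q| == #|s|)) && (v \notin q))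
    c (v |: q) = \sum_(v : V) \sum_(r : {set V} |
      (#|r| == #|s|.+1) && ((v \in r) && (f @: (r :\ v) == s))) c r.
  apply: eq_bigr => v _.
  rewrite (reindex_onto (fun r : {set V} => r :\ v) (fun q => v |: q))/=; last first.
    by move=> q /andP[_ vq]; rewrite setU1K.
  apply: eq_big => [r|r /andP[_ /eqP->]//].
  have [vr|vr] := boolP (v \in r); last first.
    rewrite andbF; apply/negP => /andP[_ /eqP rE].
    by move: vr; rewrite -rE setU11.
  by rewrite setD1K// eqxx setD11 !andbT /= (cardsD1 v r) vr add1n eqSS andbC.
rewrite [RHS](exchange_big_dep xpredT)//=; apply: eq_bigr => r _.
rewrite !sumr_const; have [rs|rs] := eqVneq #|r| #|s|.+1; last first.
  rewrite [X in _ = c r *+ X]eq_card0 => [|v]; last by rewrite !inE.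
  rewrite [X in c r *+ X = _]eq_card0// => w; rewrite !inE.
  apply/negP => /andP[ws /andP[_]]; rewrite cardsU1 ws add1n.
  exact/negP.
apply: F2_mulrn_odd; rewrite -[RHS](_ : odd #|[set v in r | f @: (r :\ v) == s]| = _); last first.
  by congr odd; apply: eq_card => v; rewrite !inE.
rewrite -odd_faces//; congr odd; apply: eq_card => w; rewrite inE unfold_in.
by case: (boolP (w \in s)) => //= ws; rewrite cardsU1 ws rs eqxx andbT.
Qed.

(* Equivariant simplicial maps; equivariance is required at vertices only. *)
Record eqmap (V W : finType) (K : Tcomplex V) (L : Tcomplex W) := EqMap {
  eqmap_fun :> V -> W;
  eqmap_simplices : forall s, s \in simplices K -> eqmap_fun @: s \in simplices L;
  eqmap_equiv : forall v, [set v] \in simplices K ->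
    eqmap_fun (vinv K v) = vinv L (eqmap_fun v) }.

Section InducedMap.
Variables (V W : finType) (K : Tcomplex V) (L : Tcomplex W) (f : eqmap K L).

Lemma push_chains m (c : chain V) : c \in chains K m -> push f c \in chains L m.
Proof.
move=> /forallP cP; apply/forallP => s; apply/implyP; rewrite ffunE => fs0.
have [r /andP[/andP[/eqP rs /eqP rE]] cr] :
    exists r : {set V}, ((f @: r == s) && (#|r| == #|s|)) && (c r != 0).
  apply/existsP; apply: contraNT fs0; rewrite negb_exists => /forallP h.
  by rewrite big1// => r rs; apply/eqP; have := h r; rewrite rs/= negbK.
have /andP[rK /eqP rm] := implyP (cP r) cr.
by rewrite -rE rm eqxx andbT -rs eqmap_simplices.
Qed.

Lemma push_vinv m (c : chain V) : c \in chains K m ->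
  push (vinv L) (push f c) = push f (push (vinv K) c).
Proof.
move=> cC; rewrite !push_comp; apply: (eq_push _ cC) => v vK /=.
by rewrite eqmap_equiv.
Qed.

Lemma push_inv_cycles m (c : chain V) :
  c \in inv_cycles K m -> push f c \in inv_cycles L m.
Proof.
move=> /andP[/andP[cC /eqP ce] /eqP bc]; apply/andP; split.
  by apply/andP; split; [exact: push_chains | rewrite (push_vinv cC) ce].
by rewrite bd_push bc push0.
Qed.

Lemma push_cycle_subproof m (c : Tcycle K m) :
  push f (Tcycle_chain c) \in inv_cycles L m.
Proof. by case: c => c cZ; exact: push_inv_cycles. Qed.

Definition push_cycle m (c : Tcycle K m) : Tcycle L m :=
  TCycle (push_cycle_subproof c).

(* The class does not depend on the representative of x. *)
Definition homology_map m (x : THomology K m) : THomology L m :=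
  (\pi_(THomology L m) (push_cycle (repr x)))%qT.

End InducedMap.

From mathcomp Require Import finmap.
From mathcomp Require Import all_classical all_reals all_analysis.
Import numFieldNormedType.Exports.

Local Open Scope classical_set_scope.
Local Open Scope quotient_scope.

Record Tspace := MkTspace {
  Tspace_sort :> topologicalType;
  tinv : Tspace_sort -> Tspace_sort;
  Tspace_compact : compact [set: Tspace_sort];
  Tspace_hausdorff : hausdorff_space Tspace_sort;
  tinv_continuous : continuous tinv;
  tinvK : involutive tinv;
  tinv_free : forall x, tinv x <> x }.

Record Tcover (X : Tspace) := MkTcover {
  members : {fset set X};
  members_open : forall U, U \in members -> open U;
  members_cover : forall x : X, exists2 U, U \in members & U x;
  members_tinv : forall U, U \in members -> @tinv X @` U \in members;
  members_free : forall U, U \in members -> U `&` @tinv X @` U = set0 }.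

Section Nerve.
Variables (X : Tspace) (C : Tcover X).

Definition nerve_simplices : {set {set members C}} :=
  [set s : {set members C} |
     (s != finset.set0) && `[< exists x : X, forall U, U \in s -> (val U) x >]]%SET.

Definition nerve_vinv (U : members C) : members C :=
  FSetSub (members_tinv (fsvalP U)).

Lemma nerve_neq0 s : s \in nerve_simplices -> s != finset.set0.
Proof. by rewrite inE => /andP[]. Qed.

Lemma nerve_sub (s r : {set members C}) :
  s \in nerve_simplices -> r \subset s -> r != finset.set0 -> r \in nerve_simplices.
Proof.
rewrite !inE => /andP[_ /asboolP[x sx]] /fintype.subsetP rs ->/=.
by apply/asboolP; exists x => U /rs; exact: sx.
Qed.

Lemma nerve_vinvK : involutive nerve_vinv.
Proof.
move=> U; apply/val_inj => /=; apply/seteqP; split => [x [_ [y Uy <-] <-]|x Ux].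
  by rewrite tinvK.
by exists (tinv x); [exists x | exact: tinvK].
Qed.

Lemma nerve_vinv_simplices (s : {set members C}) :
  s \in nerve_simplices -> (nerve_vinv @: s)%SET \in nerve_simplices.
Proof.
rewrite !inE => /andP[/set0Pn[U Us] /asboolP[x sx]]; apply/andP; split.
  by apply/set0Pn; exists (nerve_vinv U); exact: imset_f.
apply/asboolP; exists (tinv x) => _ /imsetP[W Ws ->] /=.
by exists x => //; exact: sx.
Qed.

Lemma nerve_vinv_free (s : {set members C}) :
  s \in nerve_simplices -> (nerve_vinv @: s)%SET != s.
Proof.
rewrite inE => /andP[/set0Pn[U Us] /asboolP[x sx]]; apply/eqP => sE.
have /sx /= Ux' : nerve_vinv U \in s by rewrite -sE; exact: imset_f.
have : (val U `&` @tinv X @` val U) x by split => //; exact: sx.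
by rewrite (members_free (fsvalP U)).
Qed.

Definition nerve : Tcomplex (members C) :=
  TComplex nerve_neq0 nerve_sub nerve_vinvK nerve_vinv_simplices nerve_vinv_free.

End Nerve.

(* The empty set may be a member of a cover. It is not a vertex of the nerve, and
   a refinement is not required to be equivariant there. *)
Record refinement (X : Tspace) (C D : Tcover X) := MkRefinement {
  refine_fun :> members C -> members D;
  refine_sub : forall U, val U `<=` val (refine_fun U);
  refine_equiv : forall U, val U !=set0 ->
    refine_fun (nerve_vinv U) = nerve_vinv (refine_fun U) }.

Section RefinementMap.
Variables (X : Tspace) (C D : Tcover X) (p : refinement C D).

Lemma refinement_simplices (s : {set members C}) :
  s \in simplices (nerve C) -> (p @: s)%SET \in simplices (nerve D).
Proof.
rewrite !inE => /andP[/set0Pn[U Us] /asboolP[x sx]]; apply/andP; split.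
  by apply/set0Pn; exists (p U); exact: imset_f.
apply/asboolP; exists x => _ /imsetP[W Ws ->].
by apply: refine_sub; exact: sx.
Qed.

Lemma refinement_equiv (U : members C) : [set U]%SET \in simplices (nerve C) ->
  p (vinv (nerve C) U) = vinv (nerve D) (p U).
Proof.
rewrite inE => /andP[_ /asboolP[x Ux]]; apply: refine_equiv; exists x.
by apply: Ux; rewrite inE.
Qed.

Definition refinement_map : eqmap (nerve C) (nerve D) :=
  EqMap refinement_simplices refinement_equiv.

End RefinementMap.

(* Elements of the inverse limit of the groups H_m(nerve C). *)
Record cech_homology (X : Tspace) (m : nat) := MkCech {
  cech_at : forall C : Tcover X, THomology (nerve C) m;
  cech_compat : forall (C D : Tcover X) (p : refinement C D),
    homology_map (refinement_map p) (cech_at C) = cech_at D }.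

(* The common value of the indices of the components. *)
Definition cech_index (X : Tspace) (m : nat) (x : cech_homology X m) : 'F_2 :=
  xget 0 [set e | exists C : Tcover X, e = homology_index (cech_at x C)].

Definition index_nontrivial (X : Tspace) (m : nat) : Prop :=
  exists x : cech_homology X m, cech_index x <> 0.

(* The largest m with nontrivial index. There is one as soon as X is nonempty,
   since the nerve of any cover has bounded dimension; the empty space gets -1. *)
Definition yang_index (X : Tspace) : int :=
  xget (-1) [set z : int | exists2 m : nat, z = m%:Z &
    index_nontrivial X m /\ forall j, index_nontrivial X j -> (j <= m)%N].

Lemma continuous_hausdorff (R : realType) (T : topologicalType) :
  (forall p q : T, (forall f : T -> R, continuous f -> f p = f q) -> p = q) ->
  hausdorff_space T.
Proof.
move=> sepT p q pq; apply: sepT => f fc.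
apply: (@norm_hausdorff _ R^o) => A B /fc pA /fc qB.
by have [x [Ax Bx]] := pq _ _ pA qB; exists (f x).
Qed.

Lemma continuous_mx (T : topologicalType) (R : realType) m n
  (f : T -> 'M[R]_(m, n)) :
  (forall i j, continuous (fun x => f x i j)) -> continuous f.
Proof.
move=> fc x A [P Pf PA]; rewrite nbhs_filterE.
have : \forall y \near x, forall i j, P i j (f y i j).
  apply: filter_forall => i; apply: filter_forall => j.
  exact: fc (Pf i j).
by apply: filterS => y fyP; exact: PA.
Qed.

Section MatrixContinuity.
Variables (T : topologicalType) (R : realType).

Lemma continuous_entry m n (f : T -> 'M[R]_(m, n)) i j :
  continuous f -> continuous (fun x => f x i j).
Proof.
move=> fc x.
exact: (@continuous_comp _ _ _ f (fun M : 'M[R]_(m, n) => M i j) x (fc x)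
  (@coord_continuous R m n i j (f x))).
Qed.

Lemma continuous_mulmx m n p (f : T -> 'M[R]_(m, n)) (g : T -> 'M[R]_(n, p)) :
  continuous f -> continuous g -> continuous (fun x => f x *m g x).
Proof.
move=> fc gc; apply: continuous_mx => i j.
under eq_fun do rewrite mxE.
apply: (@continuous_big R _ +%R 0 xpredT _ T _ (fun l x => f x i l * g x l j)).
  exact: (@add_continuous R^o).
move=> l _ x.
apply: (@continuousM R T (fun y => f y i l) (fun y => g y l j)).
  exact: continuous_entry.
exact: continuous_entry.
Qed.

Lemma continuous_trmx m n (f : T -> 'M[R]_(m, n)) :
  continuous f -> continuous (fun x => (f x)^T).
Proof.
move=> fc; apply: continuous_mx => i j.
under eq_fun do rewrite mxE.
exact: continuous_entry.
Qed.

Lemma continuous_det n (f : T -> 'M[R]_n) :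
  continuous f -> continuous (fun x => \det (f x)).
Proof.
move=> fc; rewrite /determinant.
apply: (@continuous_big R _ +%R 0 xpredT _ T _
  (fun (s : 'S_n) x => (-1) ^+ s * \prod_i f x i (s i))).
  exact: (@add_continuous R^o).
move=> s _ x.
apply: (@continuousM R T (fun=> _) (fun y => \prod_i f y i (s i))).
  exact: cst_continuous.
apply: (@continuous_big R _ *%R 1 xpredT _ T _ (fun i x => f x i (s i))).
  exact: mul_continuous.
move=> i _.
exact: continuous_entry.
Qed.

End MatrixContinuity.

Lemma mx_hausdorff (R : realType) m n : hausdorff_space 'M[R]_(m, n).
Proof.
apply: (@continuous_hausdorff R) => v w vw; apply/matrixP => i j.
by apply: (vw (fun x : 'M[R]_(m, n) => x i j)); exact: coord_continuous.
Qed.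

Lemma compact_set_type (T : topologicalType) (A : set T) :
  compact A -> compact [set: set_type A].
Proof.
move=> cA F FF _; pose G := set_val @ F.
have GA : G A.
  apply: (@filterE _ F _ (set_val @^-1` A)) => -[x xA].
  by rewrite /= set_valE; exact: set_mem xA.
have [x [Ax xG]] := cA G _ GA.
exists (exist _ x (mem_set Ax)); split => // B C FB [_ [[D oD <-] Dx DC]].
have GB : G (set_val @` B) by apply: (@filterS _ F _ B) FB => y By; exists y.
have xD : nbhs x D by apply: open_nbhs_nbhs; split.
have [_ [[y By <-] Dy]] := xG _ _ GB xD.
by exists y; split => //; exact: DC.
Qed.

Section Stiefel.
Variables (R : realType) (n k : nat).

(* The vectors of a frame are the columns of the matrix. *)
Definition frames : set 'M[R]_(n, k) := [set v | v^T *m v = 1%:M].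

Lemma frames_compact : compact frames.
Proof.
have fcl : closed [set u : 'rV[R]_(n * k) | frames (vec_mx u)].
  pose g (u : 'rV[R]_(n * k)) := (vec_mx u)^T *m vec_mx u.
  have vc : continuous (vec_mx : 'rV[R]_(n * k) -> 'M[R]_(n, k)).
    apply: continuous_mx => i j; under eq_fun do rewrite mxE.
    exact: coord_continuous.
  have gc : continuous g by apply: continuous_mulmx => //; exact: continuous_trmx.
  apply: (@preimage_closed _ _ g [set 1%:M]) => //.
  by apply: accessible_closed_set1; apply: hausdorff_accessible; exact: mx_hausdorff.
have fc : compact [set u : 'rV[R]_(n * k) | frames (vec_mx u)].
  apply: (subclosed_compact fcl (@rV_compact _ _ (fun=> `[(- 1 : R), 1]%classic) _)).
    by move=> _; exact: segment_compact.
  move=> u fu i; case/mxvec_indexP: i => i j /=.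
  have := congr1 (fun M : 'M[R]_k => M j j) fu; rewrite !mxE eqxx mulr1n (bigD1 i)//= => E.
  rewrite in_itv/= -ler_norml -(@expr_le1 _ 2)// -normrX ger0_norm ?sqr_ge0//.
  rewrite -E !mxE -expr2 lerDl sumr_ge0// => l _.
  by rewrite !mxE -expr2 sqr_ge0.
have -> : frames = vec_mx @` [set u : 'rV[R]_(n * k) | frames (vec_mx u)].
  apply/seteqP; split => [v fv|_ [u fu <-]//].
  by exists (mxvec v); rewrite /= mxvecK.
apply: continuous_compact fc; apply: continuous_subspaceT.
apply: continuous_mx => i j; under eq_fun do rewrite mxE.
exact: coord_continuous.
Qed.

Definition neg_last (v : 'M[R]_(n, k)) : 'M[R]_(n, k) :=
  \matrix_(i, j) if j.+1 == k then - v i j else v i j.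

Lemma neg_last_frames v : frames v -> frames (neg_last v).
Proof.
move=> /matrixP vE; apply/matrixP => i j; have := vE i j; rewrite !mxE => vij.
have -> : \sum_j0 (neg_last v)^T i j0 * neg_last v j0 j =
  (-1) ^+ (i.+1 == k) * (-1) ^+ (j.+1 == k) * \sum_j0 v^T i j0 * v j0 j.
  rewrite mulr_sumr; apply: eq_bigr => l _; rewrite !mxE.
  by do 2 case: ifP => _; rewrite ?expr0 ?expr1; ring.
rewrite vij; have [->|_] := eqVneq i j; last by rewrite !mulr0.
by rewrite -expr2 sqrr_sign mul1r.
Qed.

Lemma neg_lastK : involutive neg_last.
Proof. by move=> v; apply/matrixP => i j; rewrite !mxE; case: ifP => ->; rewrite ?opprK. Qed.

Definition Stiefel : Type := set_type frames.
HB.instance Definition _ := Topological.on Stiefel.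

Definition Stiefel_inv (v : Stiefel) : Stiefel :=
  exist _ (neg_last (val v)) (mem_set (neg_last_frames (set_mem (valP v)))).

Lemma val_frames (v : Stiefel) : (val v)^T *m val v = 1%:M.
Proof. exact: set_mem (valP v). Qed.

Lemma val_Stiefel_continuous : continuous (val : Stiefel -> 'M[R]_(n, k)).
Proof. exact: initial_continuous. Qed.

Lemma Stiefel_inv_continuous : continuous Stiefel_inv.
Proof.
apply/continuousP => _ [D oD <-].
suff c : continuous (fun v : Stiefel => neg_last (val v)).
  by move/continuousP: c; apply.
apply: continuous_mx => i j.
have e : continuous (fun x : Stiefel => val x i j).
  by apply: continuous_entry; exact: val_Stiefel_continuous.
have [jk|jk] := boolP (j.+1 == k); last first.
  by under eq_fun do rewrite mxE (negbTE jk).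
under eq_fun do rewrite mxE jk.
by move=> x; apply: (@continuousN _ R^o); exact: e.
Qed.

Lemma Stiefel_hausdorff : hausdorff_space Stiefel.
Proof.
apply: (@continuous_hausdorff R) => v w vw; apply/val_inj/matrixP => i j.
apply: (vw (fun x : Stiefel => val x i j)).
by apply: continuous_entry; exact: val_Stiefel_continuous.
Qed.

Lemma Stiefel_invK : involutive Stiefel_inv.
Proof. by move=> v; apply/val_inj; exact: neg_lastK. Qed.

Definition SO : set 'M[R]_k := [set Q | Q^T *m Q = 1%:M /\ \det Q = 1].

Definition same_plane (v w : Stiefel) : bool :=
  `[< exists2 Q, SO Q & val w = val v *m Q >].

Lemma same_plane_det v w :
  same_plane v w -> \det ((val v)^T *m val w) = 1.
Proof.
by move=> /asboolP[Q [_ dQ] ->]; rewrite mulmxA val_frames mul1mx.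
Qed.

Lemma same_plane_equiv : equiv_class_of same_plane.
Proof.
split=> [v|v w|w v u].
- by apply/asboolP; exists 1%:M; [split; rewrite ?trmx1 ?mul1mx ?det1 | rewrite mulmx1].
- suff sym a b : same_plane a b -> same_plane b a by apply/idP/idP; exact: sym.
  move=> /asboolP[Q [QQ dQ] bE]; apply/asboolP; exists Q^T.
    by split; rewrite ?det_tr// trmxK; exact: mulmx1C.
  by rewrite bE -mulmxA (mulmx1C QQ) mulmx1.
- move=> /asboolP[Q [QQ dQ] wE] /asboolP[P [PP dP] uE]; apply/asboolP.
  exists (Q *m P); last by rewrite mulmxA -wE.
  split; last by rewrite det_mulmx dQ dP mulr1.
  by rewrite trmx_mul mulmxA -(mulmxA P^T) QQ mulmx1.
Qed.

Canonical same_plane_equiv_rel := EquivRelPack same_plane_equiv.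

Definition Grassmannian : Type := quotient_topology {eq_quot same_plane}.
HB.instance Definition _ := Topological.on Grassmannian.
HB.instance Definition _ := Quotient.on Grassmannian.

(* Reverses the orientation: negates the last vector of an oriented orthonormal
   basis. *)
Definition Grassmannian_inv (x : Grassmannian) : Grassmannian :=
  \pi_Grassmannian (Stiefel_inv (repr x)).

Lemma pi_same_plane v w :
  (\pi_Grassmannian v == \pi_Grassmannian w) = same_plane v w.
Proof. by apply/eqP/idP => [/eqmodP|/eqmodP]. Qed.

Definition neg_mx : 'M[R]_k := diag_mx (\row_j if j.+1 == k then -1 else 1).

Lemma neg_lastE v : neg_last v = v *m neg_mx.
Proof.
apply/matrixP => i j; rewrite mul_mx_diag !mxE.
by case: ifP => _; rewrite ?mulrN1 ?mulr1.
Qed.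

Lemma neg_mx2 : neg_mx *m neg_mx = 1%:M.
Proof.
rewrite mulmx_diag; apply/matrixP => i j; rewrite !mxE.
by case: ifP => _; rewrite ?mulrNN mulr1.
Qed.

Lemma det_neg_mx : (0 < k)%N -> \det neg_mx = -1.
Proof.
move=> k0; have lt_k : (k.-1 < k)%N by rewrite prednK.
rewrite det_diag (bigD1 (Ordinal lt_k))//= mxE prednK// eqxx.
rewrite big1 ?mulr1// => i im; rewrite mxE ifN//.
by apply: contraNN im => ik; apply/eqP/val_inj; exact: (congr1 predn (eqP ik)).
Qed.

Lemma same_plane_inv v w :
  same_plane v w -> same_plane (Stiefel_inv v) (Stiefel_inv w).
Proof.
move=> /asboolP[Q [QQ dQ] wE]; apply/asboolP; exists (neg_mx *m Q *m neg_mx).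
  split; first rewrite !trmx_mul tr_diag_mx !mulmxA.
    rewrite -(mulmxA (_ *m _) neg_mx neg_mx) neg_mx2 mulmx1.
    by rewrite -(mulmxA _ Q^T) QQ mulmx1 neg_mx2.
  by rewrite !det_mulmx mulrAC -det_mulmx neg_mx2 det1 mul1r.
by rewrite /= !neg_lastE wE !mulmxA -(mulmxA _ neg_mx neg_mx) neg_mx2 mulmx1.
Qed.

Lemma Grassmannian_inv_pi v :
  Grassmannian_inv (\pi_Grassmannian v) = \pi_Grassmannian (Stiefel_inv v).
Proof.
apply/eqP; rewrite pi_same_plane; apply: same_plane_inv.
by rewrite -pi_same_plane reprK.
Qed.

Lemma Grassmannian_invK : involutive Grassmannian_inv.
Proof.
move=> x; have [v <-] : exists v, \pi_Grassmannian v = x by exists (repr x); exact: reprK.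
by rewrite !Grassmannian_inv_pi Stiefel_invK.
Qed.

Lemma Grassmannian_inv_continuous : continuous Grassmannian_inv.
Proof.
apply/quotient_continuous.
have -> : Grassmannian_inv \o \pi_Grassmannian = \pi_Grassmannian \o Stiefel_inv.
  by apply/funext => v; exact: Grassmannian_inv_pi.
move=> v; apply: continuous_comp; first exact: Stiefel_inv_continuous.
exact: pi_continuous.
Qed.

Lemma Stiefel_compact : compact [set: Stiefel].
Proof. exact: compact_set_type frames_compact. Qed.

Lemma Grassmannian_compact : compact [set: Grassmannian].
Proof.
have -> : [set: Grassmannian] = \pi_Grassmannian @` [set: Stiefel].
  by apply/seteqP; split => // x _; exists (repr x) => //; exact: reprK.
apply: continuous_compact Stiefel_compact.
by apply: continuous_subspaceT; exact: pi_continuous.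
Qed.

Lemma Grassmannian_hausdorff : hausdorff_space Grassmannian.
Proof.
apply: (@continuous_hausdorff R) => p q pq.
set v := repr p; set w := repr q.
have vw : val v *m (val v)^T = val w *m (val w)^T.
  apply/matrixP => i j.
  apply: (pq ((fun u : Stiefel => (val u *m (val u)^T) i j) \o repr)).
  apply: repr_comp_continuous.
    apply: continuous_entry; apply: continuous_mulmx; last apply: continuous_trmx.
      exact: val_Stiefel_continuous.
    exact: val_Stiefel_continuous.
  move=> a b; rewrite pi_same_plane => /asboolP[Q [QQ _] ->].
  by rewrite trmx_mul mulmxA -(mulmxA _ Q) (mulmx1C QQ) mulmx1.
have dvw : \det ((val v)^T *m val w) = 1.
  rewrite -(@det1 R k) -(val_frames v); apply/esym.
  apply: (pq ((fun u : Stiefel => \det ((val v)^T *m val u)) \o repr)).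
  apply: repr_comp_continuous.
    apply: continuous_det; apply: continuous_mulmx; first exact: cst_continuous.
    exact: val_Stiefel_continuous.
  move=> a b; rewrite pi_same_plane => /asboolP[Q [_ dQ] ->].
  by rewrite mulmxA det_mulmx dQ mulr1.
rewrite -(reprK p) -(reprK q); apply/eqP; rewrite pi_same_plane; apply/asboolP.
exists ((val v)^T *m val w); last first.
  by rewrite mulmxA vw -mulmxA val_frames mulmx1.
split => //; rewrite trmx_mul trmxK !mulmxA -(mulmxA _ (val v)) vw.
by rewrite !mulmxA val_frames mul1mx val_frames.
Qed.

Hypothesis k_gt0 : (0 < k)%N.

Lemma Grassmannian_inv_free x : Grassmannian_inv x <> x.
Proof.
rewrite -{2}(reprK x) => /eqP; rewrite pi_same_plane => /same_plane_det.
rewrite /= neg_lastE trmx_mul -mulmxA val_frames mulmx1 det_tr det_neg_mx//.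
by apply/eqP; rewrite eq_sym -subr_eq0 opprK paddr_eq0 ?oner_eq0.
Qed.

Lemma Stiefel_inv_free v : Stiefel_inv v <> v.
Proof.
move=> vE; apply: (@Grassmannian_inv_free (\pi_Grassmannian v)).
by rewrite Grassmannian_inv_pi vE.
Qed.

Definition Stiefel_Tspace : Tspace :=
  MkTspace Stiefel_compact Stiefel_hausdorff Stiefel_inv_continuous
    Stiefel_invK Stiefel_inv_free.

Definition Grassmannian_Tspace : Tspace :=
  MkTspace Grassmannian_compact Grassmannian_hausdorff
    Grassmannian_inv_continuous Grassmannian_invK Grassmannian_inv_free.

End Stiefel.

(* Main.v *)
From HB Require Import structures.
Require Import Defs.
From mathcomp Require Import all_boot all_order all_algebra.
From mathcomp Require Import finmap.
From mathcomp Require Import all_classical all_reals all_analysis.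
From mathcomp Require Import generic_quotient ring_quotient ring lra.
Set Implicit Arguments.
Unset Strict Implicit.
Unset Printing Implicit Defensive.
Import Order.TTheory GRing.Theory Num.Theory.
Import numFieldNormedType.Exports.

                                                                                   
                                                                                   
                                                                                  
                                                                               
                                                                                 
                                                                       
                                                                         

                                                                                 
                                                                                 
                                                                               
                                                                           
                                                                             
                                                                     

Local Open Scope ring_scope.
Local Open Scope quotient_scope.

                                         

(** The comparison of the Grassmannian with the Stiefel manifold is naturality. The projection of a
    frame to its oriented span is continuous and carries S to T. Along such a map covers pull back,
    and invariant cycles of the nerves push forward with the same index ([index_nontrivial_map],
    [yang_index_mono]).

    For the bound n - k, the frames [(e_1, ..., e_(k-1), y)], with [y] a unit vector orthogonal to
    [e_1, ..., e_(k-1)], form a sphere of dimension n - k on which S is the antipodal map. It has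
    hemispheres [c_0, ..., c_(n-k)], one in each dimension, with [bd c_(j+1) = c_j + T c_j]. The
    inductive definition of the index reduces [c_m + T c_m] to [c_0 + T c_0], whose index is 1 since
    [c_0] is a single point ([hemispheres_index]). For a given cover of the Stiefel manifold the
    hemispheres are made of short lists of points lying close together. Each point is labelled,
    compatibly with the antipodal map, by a member that contains a neighbourhood of its frame. The
    labels of one list then form a simplex of the nerve, which gives an invariant cycle of index 1
    there ([Stiefel_index_nontrivial]).

    It remains to pass to the inverse limit. The homology groups of a nerve are finite, so classes
    of index 1 in all nerves yield, along an ultrafilter, a compatible family of index 1
    ([index_nontrivialP]). This rests on two facts: the index is additive, vanishes on boundaries
    and is natural ([chain_index_additive], [chain_index_push]), and any two refinements between the
    same covers agree on homology, by a prism operator ([contiguous_homology_map]). A nerve has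
    bounded dimension, so a largest m exists ([yang_indexP]). *)

(** * Chains mod 2 *)

Lemma F2_addrr (x : 'F_2) : x + x = 0.
Proof. exact/addrr_pchar2/pchar_Fp. Qed.

Lemma F2_oppr (x : 'F_2) : - x = x.
Proof. exact/oppr_pchar2/pchar_Fp. Qed.

Lemma F2_neq0 (x : 'F_2) : x != 0 -> x = 1.
Proof. by case: x => -[|[|[]]]//= i _; apply: val_inj. Qed.

Lemma chain_addcc (V : finType) (c : chain V) : c + c = 0.
Proof. by apply/ffunP => s; rewrite !ffunE F2_addrr. Qed.

Lemma chain_oppr (V : finType) (c : chain V) : - c = c.
Proof. by apply/ffunP => s; rewrite !ffunE F2_oppr. Qed.

Lemma chain_addKc (V : finType) (c d : chain V) : c + (c + d) = d.
Proof. by rewrite addrA chain_addcc add0r. Qed.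

HB.instance Definition _ (V : finType) :=
  GRing.isZmodMorphism.Build (chain V) (chain V) (@bd V) (@bdB V).
HB.instance Definition _ (V W : finType) (f : V -> W) :=
  GRing.isZmodMorphism.Build (chain V) (chain W) (push f) (pushB f).

Lemma bdD (V : finType) (c d : chain V) : bd (c + d) = bd c + bd d.
Proof. exact: raddfD. Qed.

Lemma pushD (V W : finType) (f : V -> W) (c d : chain V) :
  push f (c + d) = push f c + push f d.
Proof. exact: raddfD. Qed.

(** Each unordered pair is counted twice, once in either order. The ranks split the sum into the two
    orders. *)
Lemma F2_sum_sym (I : finType) (g : I -> I -> 'F_2) :
  (forall i j, g i j = g j i) -> \sum_i \sum_(j | j != i) g i j = 0.
Proof.
move=> gs; rewrite (eq_bigr (fun i => \sum_(j | (enum_rank j < enum_rank i)%N) g i j +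
    \sum_(j | (enum_rank i < enum_rank j)%N) g i j)); last first.
  move=> i _; rewrite (bigID (fun j => enum_rank j < enum_rank i)%N)/=.
  congr (_ + _); apply: eq_bigl => j.
    by case: eqVneq => // ->; rewrite ltnn.
  rewrite -leqNgt leq_eqVlt; case: eqVneq => [->|ij]; first by rewrite ltnn.
  suff /negbTE -> : nat_of_ord (enum_rank i) != enum_rank j by [].
  by apply: contraNneq ij => /val_inj/enum_rank_inj ->.
rewrite big_split/= [X in _ + X](exchange_big_dep xpredT)//=.
under [X in _ + X]eq_bigr => i _ do under eq_bigr => j _ do rewrite gs.
exact: F2_addrr.
Qed.

Lemma bd_bd (V : finType) (c : chain V) : bd (bd c) = 0.
Proof.
apply/ffunP => s; rewrite !ffunE; case: ifPn => // _.
have E v : v \notin s -> bd c (v |: s)%SET =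
    \sum_(w | w != v) (if w \notin s then c (w |: (v |: s))%SET else 0).
  move=> vs; rewrite ffunE ifN; last by apply/set0Pn; exists v; rewrite finset.setU11.
  rewrite -big_mkcondr; apply: eq_bigl => w.
  by rewrite !inE negb_or.
rewrite (eq_bigr _ E) big_mkcond/=.
rewrite -[RHS](@F2_sum_sym V (fun v w => if (v \notin s) && (w \notin s) then
   c (w |: (v |: s))%SET else 0)).
  by apply: eq_bigr => v _; case: ifP => _ //=; rewrite big1.
by move=> v w; rewrite andbC; case: ifP => // _; rewrite finset.setUCA.
Qed.

(** * The index of an invariant cycle *)

Section Index.
Variables (V : finType) (K : Tcomplex V).
Implicit Types (c d e : chain V) (m : nat).
Local Notation T := (push (vinv K)).

Lemma vinv_inj : injective (vinv K).
Proof. exact: can_inj (vinvK K). Qed.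

Lemma imset_vinvK (s : {set V}) : (vinv K @: (vinv K @: s) = s)%SET.
Proof.
by rewrite -imset_comp -[RHS]imset_id; apply: eq_imset => v /=; exact: vinvK.
Qed.

Lemma imset_vinv_inj : injective (fun s : {set V} => vinv K @: s)%SET.
Proof. by move=> r s; move/(congr1 (fun q : {set V} => vinv K @: q)%SET); rewrite !imset_vinvK. Qed.

Lemma push_vinvE c (s : {set V}) : T c s = c (vinv K @: s)%SET.
Proof.
rewrite ffunE (big_pred1 (vinv K @: s)%SET)// => r.
apply/idP/eqP => [/andP[/eqP <- _]|->]; first by rewrite imset_vinvK.
by rewrite imset_vinvK !eqxx card_imset ?eqxx//; exact: vinv_inj.
Qed.

Lemma push_vinvK c : T (T c) = c.
Proof. by apply/ffunP => s; rewrite !push_vinvE imset_vinvK. Qed.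

Lemma chainsP m c : reflect
  (forall s : {set V}, c s != 0 -> s \in simplices K /\ #|s| = m.+1) (c \in chains K m).
Proof.
apply: (iffP forallP) => cP s; first by move=> /(implyP (cP s))/andP[-> /eqP].
by apply/implyP => /cP[-> ->]; rewrite eqxx.
Qed.

Lemma chainsD m c d : c \in chains K m -> d \in chains K m -> c + d \in chains K m.
Proof. by move=> cC dC; rewrite -[d]chain_oppr; exact: (chains_zmod K m).2. Qed.

Lemma push_vinv_chains m c : c \in chains K m -> T c \in chains K m.
Proof.
move=> /chainsP cP; apply/chainsP => s; rewrite push_vinvE => /cP[sK <-].
by rewrite -{1}(imset_vinvK s) vinv_simplices// card_imset//; exact: vinv_inj.
Qed.

Lemma bd_chains m c : c \in chains K m.+1 -> bd c \in chains K m.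
Proof.
move=> /chainsP cP; apply/chainsP => s; rewrite ffunE; case: ifPn => [|s0 bs].
  by rewrite eqxx.
have [v /andP[vs cvs]] : exists v, (v \notin s) && (c (v |: s)%SET != 0).
  apply/existsP; apply: contraNT bs; rewrite negb_exists => /forallP h.
  by rewrite big1// => v vs; apply/eqP; have := h v; rewrite vs/= negbK.
have [vsK] := cP _ cvs; rewrite cardsU1 vs => -[<-]; split => //.
by apply: simplices_sub vsK _ s0; exact: finset.subsetUr.
Qed.

Lemma inv_chainsP m c : reflect (c \in chains K m /\ T c = c) (c \in inv_chains K m).
Proof. by apply: (iffP andP) => -[? /eqP]. Qed.

Lemma inv_cyclesP m c :
  reflect [/\ c \in chains K m, T c = c & bd c = 0] (c \in inv_cycles K m).
Proof.
by apply: (iffP andP) => [[/inv_chainsP[? ?] /eqP]|[? ? /eqP]]//; split => //; apply/inv_chainsP.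
Qed.

(** From each orbit {s, T s} the half keeps the simplex of smaller rank; freeness of the involution
    on simplices excludes a tie. *)
Lemma inv_chain_half m c :
  c \in inv_chains K m -> exists2 d, d \in chains K m & c = d + T d.
Proof.
move=> /inv_chainsP[/chainsP cC cT].
pose half (s : {set V}) := (enum_rank s < enum_rank (vinv K @: s)%SET)%N.
exists [ffun s => if half s then c s else 0].
  by apply/chainsP => s; rewrite ffunE; case: ifP => [_ /cC|]; rewrite ?eqxx.
apply/ffunP => s; rewrite [RHS]ffunE push_vinvE !ffunE /half imset_vinvK.
rewrite -{3}cT push_vinvE imset_vinvK.
have [c0|/cC[sK _]] := eqVneq (c s) 0; first by rewrite c0 !if_same addr0.
case: ltngtP => [_|_|/val_inj/enum_rank_inj sE]; rewrite ?addr0 ?add0r//.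
by have := vinv_free sK; rewrite -sE eqxx.
Qed.

Lemma half_inv_chains m d : d \in chains K m -> d + T d \in inv_chains K m.
Proof.
move=> dC; apply/inv_chainsP; split; first exact/chainsD/push_vinv_chains.
by rewrite pushD push_vinvK addrC.
Qed.

(** Mod 2, [bd d + T (bd d) = 0] says that [bd d] is invariant. This lets the index descend by one
    dimension. *)
Lemma bd_half_inv_cycles m d :
  d \in chains K m.+1 -> bd (d + T d) = 0 -> bd d \in inv_cycles K m.
Proof.
move=> dC; rewrite bdD bd_push => dT; apply/inv_cyclesP; split.
- exact: bd_chains.
- by rewrite -[RHS]addr0 -dT chain_addKc.
- exact: bd_bd.
Qed.

(** An edge has two endpoints: the sum is rewritten over ordered pairs of vertices, where it is
    symmetric. *)
Lemma edges_sum d : d \in chains K 1 -> \sum_s bd d s = 0.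
Proof.
move=> /chainsP dC.
have d1 (s : {set V}) : #|s| != 2 -> d s = 0.
  by move=> s2; apply/eqP; apply: contraNT s2 => /dC[_ ->].
rewrite (eq_bigr (fun s : {set V} => \sum_(v | (s != finset.set0) && (v \notin s)) d (v |: s)%SET)); last first.
  by move=> s _; rewrite ffunE; case: eqP => //= _; rewrite big_pred0.
rewrite (exchange_big_dep xpredT)//=.
rewrite -[RHS](@F2_sum_sym V (fun v w => if w == v then 0 else d [set v; w]%SET)); last first.
  by move=> v w; rewrite eq_sym finset.setUC.
apply: eq_bigr => v _; rewrite [RHS]big_mkcond [LHS]big_mkcond/=.
rewrite (bigID (mem [set [set w]%SET | w : V]%SET))/= [X in _ + X]big1 ?addr0.
  rewrite big_imset/=; last by move=> x y _ _; exact: finset.set1_inj.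
  apply: eq_bigr => w _; rewrite inE.
  have -> /= : [set w]%SET != finset.set0 by apply/set0Pn; exists w; rewrite inE.
  by rewrite eq_sym; case: eqP.
move=> s; case: ifP => // /andP[s0 vs] si; apply: d1.
rewrite cardsU1 vs; apply: contraNN si => /eqP[/eqP/cards1P[w ->]].
exact: imset_f.
Qed.

Lemma sum_push_vinv c : \sum_s T c s = \sum_s c s.
Proof.
rewrite (reindex_inj (@imset_vinv_inj : injective (fun s : {set V} => _))).
by apply: eq_bigr => s _; rewrite push_vinvE imset_vinvK.
Qed.

Lemma sumcD c d : \sum_s (c + d) s = \sum_s c s + \sum_s d s.
Proof. by rewrite -big_split/=; apply: eq_bigr => s _; rewrite ffunE. Qed.

Lemma chain_indexP m c : c \in inv_chains K m -> exists d,
  [/\ d \in chains K m, c = d + T d &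
  chain_index K m c = if m is m'.+1 then chain_index K m' (bd d) else \sum_s d s].
Proof.
move=> /inv_chain_half[d dC dE]; case: m dC => [|m] dC /=; case: pickP => [d' /andP[d'C /eqP d'E]|/(_ d)].
- by exists d'.
- by rewrite dC dE eqxx.
- by exists d'.
- by rewrite dC dE eqxx.
Qed.

Lemma inv_half_diff m d d' : d \in chains K m -> d' \in chains K m ->
  d + T d = d' + T d' -> d + d' \in inv_chains K m.
Proof.
move=> dC d'C dd'; apply/inv_chainsP; split; first exact: chainsD.
rewrite pushD; have -> : T d = d + (d' + T d') by rewrite -dd' chain_addKc.
by rewrite -!addrA chain_addcc addr0.
Qed.

                                                                               
                                                                             
                                        
(** The two claims need each other in the induction. Two halves of the same cycle differ by an
    invariant chain; the boundary of that chain has index 0 one dimension lower, and additivity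
    there shows that both halves give the same index. With this independence, additivity in the next
    dimension follows by adding halves, and a boundary [bd (f + T f)] has the half [bd f], whose own
    boundary is 0. *)
Lemma chain_index_additive m :
  (forall c d, c \in inv_cycles K m -> d \in inv_cycles K m ->
     chain_index K m (c + d) = chain_index K m c + chain_index K m d) /\
  (forall c, c \in inv_chains K m.+1 -> chain_index K m (bd c) = 0).
Proof.
elim: m => [|m [IHD IHb]].
  have indD d : d \in chains K 0 -> chain_index K 0 (d + T d) = \sum_s d s.
    move=> dC; have [d' [d'C dd' ->]] := chain_indexP (half_inv_chains dC).
    have : d + d' \in inv_chains K 0 by exact: (inv_half_diff _ _ dd').
    move=> /inv_chain_half[f fC fE].
    have : \sum_s (d + d') s = 0 by rewrite fE sumcD sum_push_vinv F2_addrr.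
    by rewrite sumcD => /eqP; rewrite addr_eq0 F2_oppr => /eqP.
  split=> [c d|c].
    move=> /inv_cyclesP[cC cT _] /inv_cyclesP[dC dT _].
    have [c' c'C ->] : exists2 d, d \in chains K 0 & c = d + T d by apply/inv_chain_half/inv_chainsP.
    have [d' d'C ->] : exists2 d', d' \in chains K 0 & d = d' + T d' by apply/inv_chain_half/inv_chainsP.
    rewrite addrACA -pushD !indD// ?sumcD//; exact: chainsD.
  move=> /inv_chain_half[f fC ->]; rewrite bdD bd_push indD ?edges_sum//.
  exact: bd_chains.
have indD d : d \in chains K m.+1 -> bd (d + T d) = 0 ->
    chain_index K m.+1 (d + T d) = chain_index K m (bd d).
  move=> dC dZ; have [d' [d'C dd' ->]] := chain_indexP (half_inv_chains dC).
  have ddC : d + d' \in inv_chains K m.+1 by exact: (inv_half_diff _ _ dd').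
  have := IHb _ ddC; rewrite bdD IHD; last 2 first.
  - exact: bd_half_inv_cycles.
  - by apply: bd_half_inv_cycles; rewrite -?dd'.
  by move=> /eqP; rewrite addr_eq0 F2_oppr => /eqP.
split=> [c d /inv_cyclesP[cC cT cZ] /inv_cyclesP[dC dT dZ]|c].
  have [c' c'C cE] : exists2 d, d \in chains K m.+1 & c = d + T d by apply/inv_chain_half/inv_chainsP.
  have [d' d'C dE] : exists2 d', d' \in chains K m.+1 & d = d' + T d' by apply/inv_chain_half/inv_chainsP.
  have cdE : c + d = (c' + d') + T (c' + d') by rewrite pushD addrACA -cE -dE.
  rewrite cdE cE dE !indD -?cE -?dE//; last 2 first.
  - exact: chainsD.
  - by rewrite -cdE bdD cZ dZ addr0.
  by rewrite bdD IHD//; apply: bd_half_inv_cycles; rewrite -?cE -?dE.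
move=> /inv_chain_half[f fC ->]; rewrite bdD bd_push indD ?bd_bd.
(* The index of the zero chain is obtained by viewing it as the boundary of the zero chain. *)
- by have := IHb _ (inv_chains_zmod K m.+1).1; rewrite raddf0.
- exact: bd_chains.
- by rewrite bdD bd_push bd_bd raddf0 addr0.
Qed.


Lemma chain_indexD m c d : c \in inv_cycles K m -> d \in inv_cycles K m ->
  chain_index K m (c + d) = chain_index K m c + chain_index K m d.
Proof. exact: (chain_index_additive m).1. Qed.

Lemma chain_index_bd m c : c \in inv_chains K m.+1 -> chain_index K m (bd c) = 0.
Proof. exact: (chain_index_additive m).2. Qed.

Lemma chain_index_half m d : d \in chains K m -> bd (d + T d) = 0 ->
  chain_index K m (d + T d) =
    if m is m'.+1 then chain_index K m' (bd d) else \sum_s d s.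
Proof.
move=> dC dZ; have [d' [d'C dd' ->]] := chain_indexP (half_inv_chains dC).
have ddC := inv_half_diff dC d'C dd'.
case: m dC d'C ddC => [|m] dC d'C ddC.
  have [f fC fE] := inv_chain_half ddC.
  have : \sum_s (d + d') s = 0 by rewrite fE sumcD sum_push_vinv F2_addrr.
  by rewrite sumcD => /eqP; rewrite addr_eq0 F2_oppr => /eqP.
have := chain_index_bd ddC; rewrite bdD chain_indexD; last 2 first.
- exact: bd_half_inv_cycles.
- by apply: bd_half_inv_cycles; rewrite -?dd'.
by move=> /eqP; rewrite addr_eq0 F2_oppr => /eqP.
Qed.

End Index.

(** An equivariant map sends a half of [c] to a half of [push f c] and commutes with [bd], so the
    induction ends with vertices, whose number mod 2 is preserved. *)
Lemma chain_index_push (V W : finType) (K : Tcomplex V) (L : Tcomplex W)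
    (f : eqmap K L) m (c : chain V) :
  c \in inv_cycles K m -> chain_index L m (push f c) = chain_index K m c.
Proof.
elim: m c => [|m IH] c cZ; have /inv_cyclesP[cC cT c0] := cZ;
  have /inv_chainsP/inv_chain_half[d dC dE] := conj cC cT;
  have fE : push f c = push f d + push (vinv L) (push f d)
    by rewrite dE pushD (push_vinv _ dC).
- rewrite fE dE !chain_index_half -?fE -?dE//; last 2 first.
  + exact: push_chains.
  + by rewrite bd_push c0 raddf0.
  rewrite (eq_bigr (fun s : {set W} => \sum_(r : {set V} |
    (f @: r == s)%SET && (#|r| == #|s|)) d r)); last by move=> s _; rewrite ffunE.
  rewrite (exchange_big_dep xpredT)//=; apply: eq_bigr => r _.
  have [->|/(elimT (chainsP _ _ _) dC)[_ r1]] := eqVneq (d r) 0; first by rewrite big1.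
  have /cards1P[v rE] : #|r| == 1 by rewrite r1.
  rewrite (big_pred1 (f @: r)%SET)// => s; rewrite eq_sym andb_idr// => /eqP ->.
  by rewrite rE imset_set1 !cards1.
- rewrite fE dE !chain_index_half -?fE -?dE//; last 2 first.
  + exact: push_chains.
  + by rewrite bd_push c0 raddf0.
  by rewrite bd_push IH//; apply: bd_half_inv_cycles; rewrite -?dE.
Qed.

(** * Index and induced maps on homology classes *)

Section Homology.
Variables (V : finType) (K : Tcomplex V) (m : nat).

Lemma cycleP (z : Tcycle K m) : Tcycle_chain z \in inv_cycles K m.
Proof. by case: z. Qed.

Lemma eq_homology (y z : Tcycle K m) : reflect
  (exists2 e, e \in inv_chains K m.+1 & Tcycle_chain y + Tcycle_chain z = bd e)
  (\pi_(THomology K m) y == \pi_(THomology K m) z).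
Proof.
rewrite -Quotient.idealrBE unfold_in/=; apply: (iffP existsP) => [[e /andP[eC /eqP eE]]|[e eC eE]].
  by exists e => //; rewrite eE chain_oppr.
by exists e; rewrite eC chain_oppr eE/=.
Qed.

Lemma homology_index_pi (z : Tcycle K m) :
  homology_index (\pi_(THomology K m) z) = chain_index K m z.
Proof.
rewrite /homology_index; set y := repr _.
have /eqP/eq_homology[e eC] : \pi_(THomology K m) y = \pi_(THomology K m) z by rewrite reprK.
move=> /(congr1 (chain_index K m)); rewrite chain_index_bd// chain_indexD ?cycleP//.
by move=> /eqP; rewrite addr_eq0 F2_oppr => /eqP.
Qed.

(** Finiteness provides the compactness behind the passage to the inverse limit of the nerves. *)
Lemma finite_homology : exists s : seq (THomology K m), forall x, x \in s.
Proof.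
exists [seq \pi_(THomology K m) z |
  z <- pmap insub (enum (inv_cycles K m)) : seq (Tcycle K m)] => x.
rewrite -[x]reprK; apply: map_f; rewrite mem_pmap_sub mem_enum/=.
exact: cycleP.
Qed.

End Homology.

Section HomologyMap.
Variables (U V W : finType) (J : Tcomplex U) (K : Tcomplex V) (L : Tcomplex W).
Variable (m : nat).

Lemma homology_map_pi (f : eqmap K L) (z : Tcycle K m) :
  homology_map f (\pi_(THomology K m) z) = \pi_(THomology L m) (push_cycle f z).
Proof.
rewrite /homology_map; set y := repr _.
have /eqP/eq_homology[e eC eE] : \pi_(THomology K m) y = \pi_(THomology K m) z by rewrite reprK.
apply/eqP/eq_homology; exists (push f e); last by rewrite /= -pushD eE bd_push.
have /inv_chainsP[eK eT] := eC; apply/inv_chainsP; split; first exact: push_chains.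
by rewrite (push_vinv _ eK) eT.
Qed.

Lemma homology_index_map (f : eqmap K L) (x : THomology K m) :
  homology_index (homology_map f x) = homology_index x.
Proof.
by rewrite -[x]reprK homology_map_pi !homology_index_pi chain_index_push ?cycleP.
Qed.

Lemma homology_map_comp (f : eqmap J K) (g : eqmap K L) (h : eqmap J L)
    (x : THomology J m) : h =1 g \o f ->
  homology_map h x = homology_map g (homology_map f x).
Proof.
move=> hE; rewrite -[x]reprK !homology_map_pi; congr (\pi_(THomology L m) _).
apply: val_inj => /=; rewrite push_comp; apply/ffunP => s; rewrite !ffunE.
by apply: eq_bigl => r; rewrite (eq_imset _ hE).
Qed.

End HomologyMap.

                                     

(** * Ordered simplices and the prism operator *)

Fixpoint faces (P : Type) (l : seq P) : seq (seq P) :=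
  if l is x :: l' then l' :: [seq x :: u | u <- faces l'] else [::].

(** The terms are the lists f x_0, ..., f x_i, g x_i, ..., g x_r. A list of lists stands for a
    formal mod 2 sum of ordered simplices, degenerate ones included. *)
Fixpoint prism (P Q : Type) (f g : P -> Q) (l : seq P) : seq (seq Q) :=
  if l is x :: l' then
    (f x :: g x :: map g l') :: [seq f x :: u | u <- prism f g l']
  else [::].

Lemma faces_cons (P : Type) (x : P) (l : seq P) :
  faces (x :: l) = l :: [seq x :: u | u <- faces l].
Proof. by []. Qed.

Lemma prism_cons (P Q : Type) (f g : P -> Q) (x : P) (l : seq P) :
  prism f g (x :: l) = (f x :: g x :: map g l) :: [seq f x :: u | u <- prism f g l].
Proof. by []. Qed.

Lemma faces_map (P Q : Type) (f : P -> Q) (l : seq P) :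
  faces (map f l) = map (map f) (faces l).
Proof. by elim: l => //= x l ->; rewrite -!map_comp. Qed.

Lemma prism_map (O P Q : Type) (f g : P -> Q) (h : O -> P) (l : seq O) :
  prism f g (map h l) = prism (f \o h) (g \o h) l.
Proof. by elim: l => //= x l ->; rewrite -!map_comp. Qed.

Lemma map_prism (P Q Q' : Type) (f g : P -> Q) (h : Q -> Q') (l : seq P) :
  map (map h) (prism f g l) = prism (h \o f) (h \o g) l.
Proof. by elim: l => //= x l <-; rewrite -!map_comp. Qed.

Lemma size_prism (P Q : eqType) (f g : P -> Q) (l : seq P) (u : seq Q) :
  u \in prism f g l -> size u = (size l).+1.
Proof.
elim: l u => //= x l IH u; rewrite inE => /orP[/eqP->|/mapP[v /IH vl ->]]/=.
  by rewrite size_map.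
by rewrite vl.
Qed.

Lemma mem_prism (P Q : eqType) (f g : P -> Q) (l : seq P) (u : seq Q) q :
  u \in prism f g l -> q \in u -> exists2 p, p \in l & (q == f p) || (q == g p).
Proof.
elim: l u => //= x l IH u; rewrite inE => /orP[/eqP->|/mapP[v vl ->]].
  rewrite !inE => /or3P[/eqP->|/eqP->|/mapP[p pl ->]].
  - by exists x; rewrite ?mem_head ?eqxx.
  - by exists x; rewrite ?mem_head ?eqxx ?orbT.
  - by exists p; rewrite ?inE ?pl ?eqxx ?orbT.
rewrite inE => /orP[/eqP->|/(IH _ vl)[p pl pq]].
  by exists x; rewrite ?mem_head ?eqxx.
by exists p; rewrite // inE pl orbT.
Qed.

Lemma sum_faces_cons (P : Type) (x : P) (l : seq P) (phi : seq P -> 'F_2) :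
  \sum_(u <- faces (x :: l)) phi u = phi l + \sum_(u <- faces l) phi (x :: u).
Proof. by rewrite faces_cons big_cons big_map. Qed.

Lemma sum_prism_cons (P Q : Type) (f g : P -> Q) (x : P) (l : seq P)
    (phi : seq Q -> 'F_2) :
  \sum_(u <- prism f g (x :: l)) phi u =
  phi (f x :: g x :: map g l) + \sum_(u <- prism f g l) phi (f x :: u).
Proof. by rewrite prism_cons big_cons big_map. Qed.

(** The homotopy formula [bd P + P bd = f + g] mod 2. Formal sums of lists are compared by
    evaluating an arbitrary [phi] on them, so that the induction can be applied to [phi (f x :: u)]
    as a function of [u]. *)
Lemma faces_prism (P Q : Type) (f g : P -> Q) (l : seq P) (phi : seq Q -> 'F_2) :
  \sum_(u <- prism f g l) \sum_(v <- faces u) phi v +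
  \sum_(u <- faces l) \sum_(v <- prism f g u) phi v =
  phi (map f l) + phi (map g l).
Proof.
elim: l phi => [|x l IH] phi; first by rewrite !big_nil !F2_addrr.
rewrite sum_prism_cons 3!sum_faces_cons.
under [\sum_(u <- prism f g l) \sum_(v <- _) _]eq_bigr => u _ do rewrite sum_faces_cons.
under [\sum_(u <- faces l) \sum_(v <- _) _]eq_bigr => u _ do rewrite sum_prism_cons.
rewrite faces_map big_map !big_split/=.
have := IH (fun u => phi (f x :: u)).
set A := \sum_(u <- prism f g l) \sum_(v <- _) _.
set B := \sum_(u <- faces l) \sum_(v <- _) _ => AB.
have -> : phi (map f (x :: l)) = A + B + phi (f x :: map g l).
  by rewrite AB -[RHS]addrA F2_addrr addr0.
set C := \sum_(u <- prism f g l) phi u; set D := \sum_(u <- faces l) phi _.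
set E := phi (f x :: map g l); set G := phi (g x :: map g l).
rewrite -[LHS](_ : A + B + E + G + ((C + C) + (D + D)) = _); last by ring.
by rewrite !F2_addrr !addr0.
Qed.

(** Lists with a repeated entry are degenerate and give 0. So does the empty list, since chains are
    not augmented. *)
Definition simplex (V : finType) (l : seq V) : chain V :=
  [ffun s : {set V} => ((l != [::]) && (s == [set x in l]%SET) && (#|s| == size l))%:R].

Lemma push_simplex (V W : finType) (f : V -> W) (l : seq V) :
  push f (simplex l) = simplex (map f l).
Proof.
apply/ffunP => s; rewrite !ffunE; under eq_bigr do rewrite ffunE.
have fl : (f @: [set x in l] = [set x in map f l])%SET.
  apply/setP => w; rewrite inE; apply/imsetP/mapP => -[v vl ->]; exists v => //.
    by rewrite inE in vl.
  by rewrite inE.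
have lc : (#|[set x in l]%SET| <= size l)%N by rewrite cardsE card_size.
case: eqP => [->|l0]; first by rewrite big1.
have -> : map f l != [::] by case: (l) l0.
rewrite size_map big_mkcond (bigD1 [set x in l]%SET)//= big1 => [|r /negbTE ->]; last by rewrite if_same.
rewrite eqxx/= addr0 fl eq_sym; case: eqP => //= ->.
have fc : (#|[set x in map f l]%SET| <= #|[set x in l]%SET|)%N by rewrite -fl leq_imset_card.
case: eqP => [->//|ne]; case: eqP => //= E; case: ne.
by apply/eqP; rewrite eqn_leq fc andbT E.
Qed.

Lemma sum_faces (V : Type) (l : seq V) (phi : seq V -> 'F_2) :
  \sum_(u <- faces l) phi u = \sum_(i < size l) phi (take i l ++ drop i.+1 l).
Proof.
elim: l phi => [|x l IH] phi; first by rewrite big_nil big_ord0.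
by rewrite faces_cons big_cons big_map IH big_ord_recl/= drop0.
Qed.

(** If the list has repetitions, the left side is 0 and the faces must cancel in pairs. [odd_faces],
    applied to the map from positions to entries, covers this case together with the nondegenerate
    one. *)
Lemma bd_simplex (V : finType) (l : seq V) (s : {set V}) :
  bd (simplex l) s = \sum_(u <- faces l) simplex u s.
Proof.
rewrite ffunE; case: eqP => [->|/eqP s0].
  rewrite big1_seq// => u _; rewrite ffunE; case: eqP => //= u0; case: eqP => //= E.
  by case: u u0 E => // v u _ /setP/(_ v); rewrite !inE eqxx.
have [->|l0] := eqVneq l [::]; first by rewrite big_nil big1// => v _; rewrite ffunE.
have [x0 _] : exists x, x \in l by case: (l) l0 => // x u; exists x; rewrite mem_head.
rewrite sum_faces.
pose f (i : 'I_(size l)) := nth x0 l i.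
have fE : (f @: [set: 'I_(size l)] = [set x in l])%SET.
  apply/setP => v; rewrite inE; apply/imsetP/idP => [[i _ ->]|/(nthP x0)[i il <-]].
    exact: mem_nth.
  by exists (Ordinal il).
have fD (i : 'I_(size l)) : (f @: (finset.setT :\ i) = [set x in take i l ++ drop i.+1 l])%SET.
  apply/setP => v; rewrite inE mem_cat; apply/imsetP/orP => [[j]|].
    rewrite !inE andbT => ji ->; rewrite /f; have [lt|] := ltnP j i.
      by left; rewrite -(nth_take _ lt) mem_nth// size_take ltn_ord.
    rewrite leq_eqVlt eq_sym (inj_eq val_inj) (negbTE ji)/= => lt; right.
    by rewrite -(subnKC lt) -nth_drop mem_nth// size_drop ltn_sub2r//; apply: leq_trans (ltn_ord j).
  case=> /(nthP x0)[j].
    rewrite size_take ltn_ord => lt <-.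
    exists (Ordinal (ltn_trans lt (ltn_ord i))); last by rewrite /f nth_take.
    by rewrite !inE andbT -val_eqE/= (ltn_eqF lt).
  rewrite size_drop ltn_subRL => lt <-; exists (Ordinal lt); last by rewrite nth_drop.
  by rewrite !inE andbT -val_eqE/= gtn_eqF// leq_addr.
have [lE|lN] := eqVneq (size l) #|s|.+1; last first.
  rewrite !big1// => [i _|v vs]; rewrite ffunE.
    rewrite [X in _ && X](_ : _ = false) ?andbF//.
    rewrite size_cat size_take size_drop ltn_ord; apply/negP => /eqP sE.
    case/eqP: lN; rewrite sE -addnS subnSK ?subnKC//; exact: ltnW.
  by rewrite cardsU1 vs add1n [_.+1 == _]eq_sym (negbTE lN) andbF.
have := @odd_faces _ _ f finset.setT s; rewrite cardsT card_ord => /(_ lE).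
set A := [set w | _]%SET; set B := [set v in _ | _]%SET => AB.
rewrite [LHS](_ : _ = \sum_(v in A) 1); last first.
  rewrite [RHS]big_mkcond [LHS]big_mkcond; apply: eq_bigr => v _.
  rewrite inE ffunE l0; case: ifP => //= vs; rewrite fE cardsU1 vs lE eqxx andbT.
  by rewrite eq_sym; case: eqP.
rewrite [RHS](_ : _ = \sum_(i in B) 1); last first.
  rewrite [RHS]big_mkcond; apply: eq_bigr => i _.
  rewrite !inE ffunE /= fD.
  have -> : #|s| == size (take i l ++ drop i.+1 l).
    by rewrite size_cat size_take size_drop ltn_ord -eqSS -lE -addnS subnSK ?subnKC// ltnW.
  have -> : take i l ++ drop i.+1 l != [::].
    apply: contraNneq s0 => E; move/(congr1 size): E.
    rewrite size_cat size_take size_drop ltn_ord => E.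
    by rewrite -cards_eq0 -eqSS -lE -(subnKC (ltnW (ltn_ord i))) -subnSK// addnS E.
  by rewrite andbT/= eq_sym; case: eqP.
by rewrite !sumr_const; exact: F2_mulrn_odd.
Qed.

                                    

(** * Contiguous equivariant maps agree on homology *)

Lemma F2_sum_supp (I : finType) (z F : I -> 'F_2) :
  \sum_(i | z i != 0) F i = \sum_i z i * F i.
Proof.
rewrite big_mkcond; apply: eq_bigr => i _; case: eqVneq => [->|/F2_neq0->].
  by rewrite mul0r.
by rewrite mul1r.
Qed.

Lemma eq_prism (P : eqType) (Q : Type) (f g f' g' : P -> Q) (l : seq P) :
  {in l, f =1 f'} -> {in l, g =1 g'} -> prism f g l = prism f' g' l.
Proof.
elim: l => //= x l IH fE gE; rewrite fE ?mem_head// gE ?mem_head//.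
rewrite IH => [|v vl|v vl]; try by [apply: fE; rewrite inE vl orbT|apply: gE; rewrite inE vl orbT].
congr ((_ :: _ :: _) :: _); apply/eq_in_map => v vl; apply: gE.
by rewrite inE vl orbT.
Qed.

Lemma sum_faces_uniq (P : eqType) (l : seq P) (phi : seq P -> 'F_2) : uniq l ->
  \sum_(u <- faces l) phi u = \sum_(x <- l) phi [seq y <- l | y != x].
Proof.
elim: l phi => [|x l IH] phi; first by rewrite !big_nil.
rewrite cons_uniq => /andP[xl lu].
rewrite sum_faces_cons big_cons/= eqxx IH//; congr (phi _ + _).
  apply/esym/all_filterP/allP => y yl; apply: contraNneq xl => <-//.
rewrite [LHS]big_seq [RHS]big_seq; apply: eq_bigr => y yl.
by case: eqVneq => // xy; rewrite xy yl in xl.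
Qed.

Lemma simplexP (V : finType) (l : seq V) (s : {set V}) :
  reflect [/\ l != [::], s = [set x in l]%SET & #|s| = size l] (simplex l s != 0).
Proof.
rewrite ffunE -andbA; apply: (iffP idP) => [|[-> <- ->]]; last by rewrite !eqxx oner_eq0.
by case: and3P => [[l0 /eqP ? /eqP ?]|]; rewrite ?eqxx.
Qed.

Section OrderedSimplex.
Variables (V : finType) (K : Tcomplex V).

                                                                                 
                                                                                 
(** A key constant on the orbits of the involution, so that sorting vertices by it is compatible
    with the involution. *)
Definition orbit_key (v : V) : nat := minn (enum_rank v) (enum_rank (vinv K v)).

Definition ordered (s : {set V}) : seq V :=
  [seq v <- sort (relpre orbit_key leq) (enum V) | v \in s].

Lemma mem_ordered s : ordered s =i s.
Proof. by move=> v; rewrite mem_filter mem_sort mem_enum andbT. Qed.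

Lemma ordered_uniq s : uniq (ordered s).
Proof. by rewrite filter_uniq// sort_uniq enum_uniq. Qed.

Lemma size_ordered s : size (ordered s) = #|s|.
Proof. by rewrite -(card_uniqP (ordered_uniq s)); apply: eq_card; exact: mem_ordered. Qed.

Lemma orderedD1 s v : ordered (s :\ v) = [seq w <- ordered s | w != v].
Proof. by rewrite -filter_predI; apply: eq_filter => w; rewrite !inE. Qed.

Lemma simplex_ordered (s r : {set V}) : s != finset.set0 ->
  simplex (ordered s) r = (r == s)%:R.
Proof.
move=> s0; rewrite ffunE size_ordered.
have -> : [set x in ordered s]%SET = s by apply/setP => v; rewrite inE mem_ordered.
have -> : ordered s != [::].
  by apply: contraNneq s0 => s0; rewrite -cards_eq0 -size_ordered s0.
by case: eqP => //= ->; rewrite eqxx.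
Qed.

Lemma orbit_key_vinv v : orbit_key (vinv K v) = orbit_key v.
Proof. by rewrite /orbit_key vinvK minnC. Qed.

(** The key separates orbits, and a simplex meets each orbit at most once: the edge joining [v] and
    [vinv K v] would be mapped onto itself. *)
Lemma orbit_key_inj s : s \in simplices K -> {in s &, injective orbit_key}.
Proof.
move=> sK v w vs ws.
have [vw|vw] := eqVneq v (vinv K w); last first.
  have rk (a b : V) : enum_rank a = enum_rank b :> nat -> a = b.
    by move=> /val_inj/enum_rank_inj.
  rewrite /orbit_key /minn; do 2 case: ifP => _; move=> /rk//.
  - by move/eqP; rewrite (negbTE vw).
  - by move/eqP; rewrite eq_sym -(inj_eq (vinv_inj (K := K))) vinvK eq_sym (negbTE vw).
  - exact: vinv_inj.
have : [set v; w]%SET \in simplices K.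
  apply: simplices_sub sK _ _; last by apply/set0Pn; exists v; rewrite !inE eqxx.
  by apply/fintype.subsetP => u; rewrite !inE => /orP[]/eqP->.
move/vinv_free; rewrite imsetU1 imset_set1 vw vinvK [in X in X == _]finset.setUC.
by rewrite -vw eqxx.
Qed.

(** Both lists are sorted by the invariant key and have the same entries; the key is injective on a
    simplex, so they coincide. This makes the prism operator equivariant. *)
Lemma ordered_vinv (s : {set V}) : s \in simplices K ->
  ordered (vinv K @: s)%SET = map (vinv K) (ordered s).
Proof.
move=> sK.
have so r : sorted (relpre orbit_key leq) (ordered r).
  apply: sorted_filter; first by move=> u v w /=; exact: leq_trans.
  by apply: sort_sorted => u v /=; exact: leq_total.
apply: (@sorted_eq_in _ (relpre orbit_key leq)).
- by move=> u v w _ _ _ /=; exact: leq_trans.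
- move=> u v; rewrite !mem_ordered => us vs /= /anti_leq.
  by apply: orbit_key_inj us vs; exact: vinv_simplices.
- exact: so.
- rewrite sorted_map; rewrite -(eq_sorted (e := relpre orbit_key leq)) ?so//.
  by move=> u v /=; rewrite !orbit_key_vinv.
apply: uniq_perm; rewrite ?(map_inj_uniq (@vinv_inj _ K)) ?ordered_uniq// => v.
rewrite mem_ordered; apply/imsetP/mapP => -[w]; rewrite ?mem_ordered => ws ->;
  by exists w; rewrite ?mem_ordered.
Qed.

(** Collected by faces, the term [phi (ordered r)] occurs with coefficient [bd z r]. The empty face
    is handled by the condition on [phi [::]], as [bd] is set to 0 there. *)
Lemma sum_faces_cycle (z : chain V) (phi : seq V -> 'F_2) :
  bd z = 0 -> phi [::] = 0 ->
  \sum_(s : {set V} | z s != 0) \sum_(u <- faces (ordered s)) phi u = 0.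
Proof.
move=> z0 phi0; rewrite F2_sum_supp.
rewrite (eq_bigr (fun s : {set V} => \sum_(v in s) z s * phi (ordered (s :\ v)%SET))); last first.
  move=> s _; rewrite sum_faces_uniq ?ordered_uniq// mulr_sumr.
  rewrite -(eq_bigl _ _ (mem_ordered s)) -big_uniq ?ordered_uniq//=.
  by apply: eq_bigr => v _; rewrite orderedD1.
rewrite (exchange_big_dep xpredT)//=.
rewrite (eq_bigr (fun v => \sum_(r : {set V} | v \notin r) z (v |: r)%SET * phi (ordered r))); last first.
  move=> v _; rewrite (reindex_onto (fun r : {set V} => v |: r)%SET (fun s => s :\ v)%SET)/=.
    apply: eq_big => [r|r /andP[_ /eqP ->]//].
    rewrite finset.setU11/=; apply/eqP/idP => [<-|]; first by rewrite !inE eqxx.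
    exact: setU1K.
  by move=> s; exact: finset.setD1K.
rewrite (exchange_big_dep xpredT)//= big1// => r _.
rewrite -mulr_suml; have [->|r0] := eqVneq r finset.set0.
  have -> : ordered finset.set0 = [::] by apply: size0nil; rewrite size_ordered cards0.
  by rewrite phi0 mulr0.
have := congr1 (fun c : chain V => c r) z0; rewrite !ffunE (negbTE r0) => ->.
by rewrite mul0r.
Qed.

End OrderedSimplex.

Section Contiguous.
Variables (V W : finType) (K : Tcomplex V) (L : Tcomplex W) (p q : eqmap K L).
Hypothesis pq : forall s : {set V},
  s \in simplices K -> (p @: s :|: q @: s)%SET \in simplices L.

Definition prism_chain (c : chain V) : chain W :=
  \sum_(s : {set V} | c s != 0) \sum_(u <- prism p q (ordered K s)) simplex u.

Lemma push_ordered m (c : chain V) (f : V -> W) : c \in chains K m ->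
  push f c = \sum_(s : {set V} | c s != 0) simplex (map f (ordered K s)).
Proof.
move=> /chainsP cC.
have {1}-> : c = \sum_(s : {set V} | c s != 0) simplex (ordered K s).
  apply/ffunP => r; rewrite sum_ffunE.
  rewrite (eq_bigr (fun s => (r == s)%:R)); last first.
    by move=> s /cC[/simplices_neq0 s0 _]; rewrite simplex_ordered.
  have [cr|cr] := eqVneq (c r) 0.
    by rewrite cr big1// => s cs; case: eqP => // rs; rewrite -rs cr eqxx in cs.
  rewrite (bigD1 r)//= eqxx big1 ?addr0; first exact: F2_neq0.
  by move=> s /andP[_ /negbTE]; rewrite eq_sym => ->.
by rewrite raddf_sum; apply: eq_bigr => s _; exact: push_simplex.
Qed.

Lemma prism_chain_chains m (c : chain V) :
  c \in chains K m -> prism_chain c \in chains L m.+1.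
Proof.
move=> /chainsP cC; apply/chainsP => t; rewrite sum_ffunE => t0.
have [s /andP[cs ts]] : exists s : {set V}, (c s != 0) &&
    ((\sum_(u <- prism p q (ordered K s)) simplex u) t != 0).
  apply/existsP; apply: contraNT t0; rewrite negb_exists => /forallP h.
  by rewrite big1// => s cs; apply/eqP; have := h s; rewrite cs/= negbK.
have [u us /simplexP[u0 tE tc]] : exists2 u, u \in prism p q (ordered K s) & simplex u t != 0.
  apply/hasP; apply: contraNT ts => /hasPn h.
  by rewrite sum_ffunE big1_seq// => u /= /h; rewrite negbK => /eqP.
have [sK sm] := cC _ cs; rewrite tc (size_prism us) size_ordered sm; split => //.
apply: simplices_sub (pq sK) _ _; last by rewrite -cards_eq0 tc size_eq0.
apply/fintype.subsetP => w; rewrite tE !inE => wu.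
have [v] := mem_prism us wu; rewrite mem_ordered => vs /orP[]/eqP->; apply/orP.
  by left; exact: imset_f.
by right; exact: imset_f.
Qed.

Lemma prism_chain_inv m (c : chain V) :
  c \in inv_chains K m -> prism_chain c \in inv_chains L m.+1.
Proof.
move=> /inv_chainsP[cC cT]; apply/inv_chainsP; split; first exact: prism_chain_chains.
rewrite /prism_chain raddf_sum [RHS](reindex_inj (@imset_vinv_inj _ K))/=.
apply: eq_big => [s|s cs]; first by rewrite -{1}cT push_vinvE.
have [sK _] := elimT (chainsP _ _ _) cC _ cs.
rewrite ordered_vinv// prism_map raddf_sum.
rewrite (eq_bigr (fun u => simplex (map (vinv L) u)) (fun u _ => push_simplex _ u)).
rewrite -(big_map (map (vinv L)) xpredT (@simplex W)) map_prism.
have vK v : v \in s -> [set v]%SET \in simplices K.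
  move=> vs; apply: simplices_sub sK _ _; first by rewrite finset.sub1set.
  by apply/set0Pn; exists v; rewrite inE.
by congr (\sum_(u <- _) _); apply: eq_prism => v; rewrite mem_ordered => /vK vK' /=;
  rewrite eqmap_equiv.
Qed.

(** The homotopy formula, summed over the simplices of [c], leaves the prisms over all their faces.
    These cancel by [sum_faces_cycle], since [c] is a cycle. *)
Lemma bd_prism_chain m (c : chain V) : c \in chains K m -> bd c = 0 ->
  bd (prism_chain c) = push p c + push q c.
Proof.
move=> cC c0; rewrite !(push_ordered _ cC) /prism_chain raddf_sum -big_split/=.
apply/ffunP => t; rewrite !sum_ffunE -[RHS]addr0.
rewrite -[X in _ = _ + X](@sum_faces_cycle _ K c (fun l => \sum_(v <- prism p q l) simplex v t))//; last first.
  by rewrite big_nil.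
rewrite -big_split/=; apply: eq_bigr => s _.
rewrite raddf_sum sum_ffunE ffunE -(faces_prism p q (ordered K s) (fun l => simplex l t)).
rewrite -addrA F2_addrr addr0.
by apply: eq_bigr => u _; exact: bd_simplex.
Qed.

Lemma contiguous_homology_map m (x : THomology K m) :
  homology_map p x = homology_map q x.
Proof.
rewrite -[x]reprK !homology_map_pi; apply/eqP/eq_homology.
have /inv_cyclesP[zC zT z0] := cycleP (repr x).
exists (prism_chain (repr x)); first by apply: prism_chain_inv; apply/inv_chainsP.
by rewrite (bd_prism_chain zC z0).
Qed.

End Contiguous.

Local Open Scope classical_set_scope.

                                 

(** * Invariant covers and their refinements *)

(** An arbitrary choice [g] is used at one representative of each orbit and transported by [tB] to
    the other point. At a fixed point of [tA] equivariance would force the value to be fixed by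
    [tB], hence the restriction. *)
Lemma equivariant_choice (A : choiceType) (B : Type) (tA : A -> A) (tB : B -> B)
    (E : A -> B -> Prop) :
  involutive tA -> (forall a b, E a b -> E (tA a) (tB b)) ->
  involutive tB -> (forall a, exists b, E a b) ->
  exists f : A -> B, (forall a, E a (f a)) /\
    (forall a, tA a <> a -> f (tA a) = tB (f a)).
Proof.
move=> tAK tE tBK /choice[g gE].
pose orb a := [pred x : A | (x == a) || (x == tA a)].
pose rep a := choose (orb a) a.
have repT a : rep (tA a) = rep a.
  rewrite /rep (@eq_choose _ _ (orb a)) => [|x]; last by rewrite /= tAK orbC.
  by apply: choose_id; rewrite /= eqxx ?orbT.
exists (fun a => if rep a == a then g a else tB (g (tA a))); split=> a.
  by case: ifP => // _; rewrite -{1}(tAK a); apply: tE; exact: gE.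
move=> aT; rewrite repT tAK.
have : orb a (rep a) by apply: chooseP; rewrite /= eqxx.
case/orP => /eqP ->; rewrite eqxx ifN ?tBK//; first by apply/eqP => /esym.
exact/eqP.
Qed.

Section Covers.
Variable X : Tspace.
Implicit Types (C D E : Tcover X) (U : set X).

Lemma tinv_image U : @tinv X @` U = @tinv X @^-1` U.
Proof.
apply/seteqP; split => [_ [x Ux <-]|x Ux]; first by rewrite /= tinvK.
by exists (tinv x); rewrite // tinvK.
Qed.

Lemma open_tinv U : open U -> open (@tinv X @` U).
Proof.
by rewrite tinv_image; apply: open_comp => x _; exact: tinv_continuous.
Qed.

Lemma tinv_images U : @tinv X @` (@tinv X @` U) = U.
Proof. by rewrite !tinv_image; apply/funext => x; rewrite /preimage/= tinvK. Qed.

Lemma nerve_vinv_neq C (U : members C) : val U !=set0 -> nerve_vinv U <> U.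
Proof.
move=> [x Ux] /(congr1 val)/= UE; have := members_free (fsvalP U).
by rewrite UE setIid => U0; have : (set0 : set X) x by rewrite -U0.
Qed.

Lemma nerveP C (s : {set members C}) : reflect
  (s != finset.set0 /\ exists x : X, forall U : members C, U \in s -> val U x)
  (s \in simplices (nerve C)).
Proof. by rewrite inE; apply: (iffP andP) => -[? /asboolP]. Qed.

(** If [A] and [B] separate [x] from [tinv x], a common point of [A] intersected with the preimage
    of [B] and of its image would lie in both [A] and [B]. *)
Lemma near_free (x : X) : exists U, [/\ open U, U `&` @tinv X @` U = set0 & U x].
Proof.
have [[A B] [Ax Bx] [oA oB AB]] : exists2 AB : set X * set X,
    (x \in AB.1 /\ tinv x \in AB.2) & [/\ open AB.1, open AB.2 & AB.1 `&` AB.2 == set0].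
  have := @Tspace_hausdorff X; rewrite open_hausdorff => /(_ x (tinv x)).
  by apply; apply/eqP => /esym; exact: tinv_free.
move: Ax Bx oA oB AB; rewrite !inE /= => Ax Bx oA oB /eqP AB; exists (A `&` @tinv X @^-1` B); split.
- by apply: openI => //; apply: open_comp => // y _; exact: tinv_continuous.
- rewrite tinv_image -subset0 => y [[Ay By]] [/= Ay' By'].
  rewrite tinvK in By'; have AB0 : A `&` B = set0 by apply/eqP.
  by have : (A `&` B) y by []; rewrite AB0.
- by split.
Qed.

Lemma Tcover_exists : exists C : Tcover X, True.
Proof.
pose free U := open U /\ U `&` @tinv X @` U = set0.
(* Compactness is used in its near-covering form. Along [F], a finite family eventually contains any
   prescribed one, so some finite family of free open sets covers [X]; adding the images under
   [tinv] makes it invariant. *)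
pose F : set_system {fset set X} :=
  filter_from setT (fun t : {fset set X} => [set s : {fset set X} | {subset t <= s}]).
have FF : Filter F.
  apply: filter_from_filter; first by exists fset0.
  move=> s t _ _; exists (s `|` t)%fset => // r str.
  by split => U Us; apply: str; rewrite in_fsetU Us ?orbT.
have : \forall s \near F, [set: X] `<=` (fun x => exists U : set X, [/\ U \in s, free U & U x]).
  apply: (iffLR (compact_near_coveringP [set: X]) (@Tspace_compact X)) => x _.
  have [U [oU fU Ux]] := near_free x.
  exists (U, [set s : {fset set X} | U \in s]); first split => /=.
  - exact: open_nbhs_nbhs.
  - by exists [fset U]%fset => // s Us; apply: Us; rewrite inE.
  by move=> [y s] [/= Uy Us]; exists U.
case=> t _ /(_ t (fun _ => id)) tX.
pose g := [fset U in t | `[< free U >]]%fset.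
have gP (U : set X) : (U \in g) = (U \in t) && `[< free U >] by rewrite !inE.
pose im (U : set X) : set X := @tinv X @` U.
pose gg : {fset set X} := (g `|` [fset im U | U in g])%fset.
have ggP (U : set X) : U \in gg -> U \in g \/ (@tinv X @` U) \in g.
  rewrite inE => /orP[|/imfsetP[/= W Wg ->]]; first by left.
  by right; rewrite tinv_images.
have gfree (U : set X) : U \in g -> free U by rewrite gP => /andP[_ /asboolP].
unshelve eexists (@MkTcover X gg _ _ _ _) => //.
- move=> U /ggP[/gfree[]//|/gfree[+ _]] => /open_tinv.
  by rewrite tinv_images.
- move=> x; have [U [Ut fU Ux]] := tX x I.
  by exists U => //; rewrite inE gP Ut; move/asboolP: fU => ->.
- move=> U /ggP[Ug|Ug]; rewrite inE; last by rewrite Ug.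
  by apply/orP; right; exact: in_imfset.
- move=> U /ggP[/gfree[]//|/gfree[_]].
  by rewrite tinv_images setIC.
Qed.

Lemma common_refinement C D : exists E : Tcover X,
  (forall U, U \in members E -> exists2 V, V \in members C & U `<=` V) /\
  (forall U, U \in members E -> exists2 V, V \in members D & U `<=` V).
Proof.
pose M := [fset (U `&` V)%classic | U in members C, V in members D]%fset.
have MP W : W \in M ->
    exists U V, [/\ U \in members C, V \in members D & W = U `&` V].
  by case/imfset2P => U /= UC [V /= VD ->]; exists U, V.
have MI U V : U \in members C -> V \in members D -> U `&` V \in M.
  by move=> UC VD; exact: in_imfset2.
unshelve eexists (@MkTcover X M _ _ _ _).
- move=> _ /MP[U [V [UC VD ->]]].
  by apply: openI; [exact: members_open UC|exact: members_open VD].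
- move=> x; have [U UC Ux] := members_cover C x.
  by have [V VD Vx] := members_cover D x; have UV := MI _ _ UC VD; exists (U `&` V).
- move=> _ /MP[U [V [UC VD ->]]].
  have -> : @tinv X @` (U `&` V) = @tinv X @` U `&` @tinv X @` V.
    by rewrite !tinv_image.
  by apply: MI; exact: members_tinv.
- move=> _ /MP[U [V [UC VD ->]]]; have := members_free UC.
  rewrite !tinv_image -!subset0 => h x [[Ux Vx] [Ux' _]].
  by apply: (h x); split.
split=> _ /MP[U [V [UC VD ->]]]; first by exists U => // x [].
by exists V => // x [].
Qed.

End Covers.

Section CoverMap.
Variables (X Y : Tspace) (h : X -> Y).
Hypothesis hT : forall x, h (tinv x) = tinv (h x).
Variables (C : Tcover X) (D : Tcover Y).
Hypothesis hCD : forall U, U \in members C -> exists2 V, V \in members D & h @` U `<=` V.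

Lemma cover_map : exists f : members C -> members D,
  (forall U, h @` val U `<=` val (f U)) /\
  (forall U, val U !=set0 -> f (nerve_vinv U) = nerve_vinv (f U)).
Proof.
pose E (U : members C) (V : members D) := h @` val U `<=` val V.
have ET U V : E U V -> E (nerve_vinv U) (nerve_vinv V).
  move=> UV _ [_ [x Ux <-] <-]; rewrite hT /=; exists (h x) => //.
  by apply: UV; exists x.
have Eex U : exists V, E U V.
  by have [V VD UV] := hCD (fsvalP U); exists (FSetSub VD).
have [f [fE fT]] := equivariant_choice (@nerve_vinvK X C) ET (@nerve_vinvK Y D) Eex.
exists f; split => // U U0; apply: fT; exact: nerve_vinv_neq.
Qed.

Lemma cover_eqmap : exists f : eqmap (nerve C) (nerve D), True.
Proof.
have [f [fE fT]] := cover_map; unshelve eexists (@EqMap _ _ _ _ f _ _) => //.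
  move=> s /nerveP[/set0Pn[U Us] [x sx]]; apply/nerveP; split.
    by apply/set0Pn; exists (f U); exact: imset_f.
  exists (h x) => _ /imsetP[W Ws ->]; apply: fE; exists x => //; exact: sx.
move=> U /nerveP[_ [x Ux]]; apply: fT; exists x; apply: Ux; exact: set11.
Qed.

End CoverMap.

(** * Cech classes and the Yang index *)

Section Cech.
Variable X : Tspace.
Implicit Types (C D E : Tcover X).

Lemma refinement_exists C D :
  (forall U, U \in members C -> exists2 V, V \in members D & U `<=` V) ->
  exists p : refinement C D, True.
Proof.
move=> CD; have [|f [fE fT]] := @cover_map X X id (fun _ => erefl) C D.
  by move=> U /CD[V VD UV]; exists V; rewrite // image_id.
by unshelve eexists (@MkRefinement X C D f _ fT) => // U; rewrite -[val U]image_id.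
Qed.

(** Two refinements are contiguous: a point common to the members in [s] also lies in all their
    images under [p] and under [q]. *)
Lemma refinement_homology_map m C D (p q : refinement C D) (x : THomology (nerve C) m) :
  homology_map (refinement_map p) x = homology_map (refinement_map q) x.
Proof.
apply: contiguous_homology_map => s /nerveP[/set0Pn[U Us] [y sy]].
apply/nerveP; split; first by apply/set0Pn; exists (p U); rewrite inE imset_f.
exists y => V; rewrite inE => /orP[] /imsetP[W Ws ->]; apply: refine_sub; exact: sy.
Qed.

Lemma refinement_comp_map m C D E (p : refinement C D) (q : refinement D E)
    (r : refinement C E) (x : THomology (nerve C) m) :
  homology_map (refinement_map r) x =
  homology_map (refinement_map q) (homology_map (refinement_map p) x).
Proof.
have qpS U : val U `<=` val (q (p U)).
  by move=> y Uy; do 2 apply: refine_sub.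
have qpT U : val U !=set0 -> q (p (nerve_vinv U)) = nerve_vinv (q (p U)).
  move=> [y Uy]; rewrite (refine_equiv p); last by exists y.
  by rewrite (refine_equiv q)//; exists y; apply: refine_sub.
rewrite (refinement_homology_map r (@MkRefinement X C E (fun U => q (p U)) qpS qpT)).
exact: homology_map_comp.
Qed.

Lemma ultra_seq (T : Type) (I : eqType) (G : set_system T) (A : I -> set T) (s : seq I) :
  UltraFilter G -> G (fun t => exists2 i, i \in s & A i t) -> exists i, G (A i).
Proof.
move=> GU; elim: s => [G0|i s IH Gs].
  exfalso; apply: (@filter_not_empty _ G); apply: filterS G0 => t [].
  by [].
have [|GC] := in_ultra_setVsetC (A i) GU; first by exists i.
apply: IH; apply: filterS2 Gs GC => t [j]; rewrite inE => /orP[/eqP->//|js At _].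
by exists j.
Qed.

                                                                                  
                                                                
(** Refinement maps preserve the index, so all components of a Cech class have the same index, as
    seen on a common refinement. Conversely, classes of index 1 chosen in each nerve, without any
    compatibility, are turned into a compatible family by taking limits along an ultrafilter. *)
Lemma index_nontrivialP m : index_nontrivial X m <->
  forall C, exists z : Tcycle (nerve C) m, chain_index (nerve C) m z = 1.
Proof.
split=> [[x]|cyc].
  have xE C D (p : refinement C D) :
      homology_index (cech_at x D) = homology_index (cech_at x C).
    by rewrite -(cech_compat x p) homology_index_map.
  rewrite /cech_index; case: xgetP => [e -> [C0 eE] e0 C|_ //].
  have [E [/refinement_exists[p _] /refinement_exists[q _]]] := common_refinement C0 C.
  exists (repr (cech_at x C)); rewrite -homology_index_pi reprK.
  by rewrite (xE _ _ q) -(xE _ _ p) -eE; apply: F2_neq0; apply/eqP.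
have zex C : exists z : THomology (nerve C) m, homology_index z = 1.
  by have [z zE] := cyc C; exists (\pi_(THomology (nerve C) m) z); rewrite homology_index_pi.
pose z C := sval (cid (zex C)).
have zP C : homology_index (z C) = 1 by exact: svalP (cid (zex C)).
(* The filter of all sufficiently fine covers, to be extended to an ultrafilter [G]. *)
pose F : set_system (Tcover X) :=
  filter_from setT (fun D => [set C | exists p : refinement C D, True]).
have FF : ProperFilter F.
  apply: filter_from_proper; last first.
    by move=> C _; exists C; apply: refinement_exists => U UC; exists U.
  apply: filter_from_filter.
    by have [C _] := Tcover_exists X; exists C.
  move=> C D _ _; have [E [/refinement_exists[p _] /refinement_exists[q _]]] := common_refinement C D.
  have comp E' D' E'' (p' : refinement E' D') (q' : refinement D' E'') :
      exists r : refinement E' E'', True.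
    apply: refinement_exists => U UE; exists (val (q' (p' (FSetSub UE)))); first exact: fsvalP.
    by move=> y Uy; do 2 apply: refine_sub.
  by exists E => // E' [r _]; split; apply: comp r _.
have [G [GU FG]] := ultraFilterLemma FF.
pose val_at D (h : THomology (nerve D) m) C :=
  exists p : refinement C D, homology_map (refinement_map p) (z C) = h.
(* As [C] gets finer, the image of [z C] moves in the finite group over [D]; one value is taken for
   all [C] in a set of [G], and it serves as the component at [D]. *)
have limit D : exists h, G (val_at D h).
  have [s sP] := finite_homology (nerve D) m.
  apply: (@ultra_seq _ _ _ _ s GU).
  have : G [set C | exists p : refinement C D, True] by apply: FG; exists D.
  apply: filterS => C [p _]; exists (homology_map (refinement_map p) (z C)) => //.
  by exists p.
pose f D := sval (cid (limit D)).
have fP D : G (val_at D (f D)) by exact: svalP (cid (limit D)).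
(* Both limit values are attained at one cover [E], as images of the same class [z E]; refinements
   from [E] to [D] agree on homology. *)
have fC C D (p : refinement C D) : homology_map (refinement_map p) (f C) = f D.
  have [E [[q <-] [r <-]]] := filter_ex (filterI (fP C) (fP D)).
  by rewrite -(refinement_comp_map q p r).
exists (MkCech fC); rewrite /cech_index; have [C0 _] := Tcover_exists X.
case: xgetP => [e -> [C ->] /=|/(_ (homology_index (f C0)))]; last by case; exists C0.
have [E [q <-]] := filter_ex (fP C).
by rewrite homology_index_map zP; apply/eqP; rewrite oner_eq0.
Qed.

(** A simplex of the nerve has at most as many vertices as [C] has members, so in higher degrees the
    only cycle is 0, of index 0. *)
Lemma index_nontrivial_bounded m C : index_nontrivial X m -> (m <= #|{: members C}|)%N.
Proof.
move=> /index_nontrivialP/(_ C)[z zE]; rewrite leqNgt; apply/negP => ltm.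
have /inv_cyclesP[/chainsP zC _ _] := cycleP z.
have z0 : Tcycle_chain z = 0.
  apply/ffunP => s; rewrite ffunE; apply/eqP; apply: contraTT isT => /zC[_ sm].
  have := max_card (mem s); rewrite sm leqNgt ltnS; by rewrite ltnW.
have /eqP := zE; rewrite z0 -[0](raddf0 (@bd (members C))) chain_index_bd.
  by rewrite eq_sym oner_eq0.
exact: (inv_chains_zmod (nerve C) m.+1).1.
Qed.

Lemma yang_indexP m : index_nontrivial X m -> exists n : nat,
  [/\ yang_index X = n%:Z, index_nontrivial X n &
   forall j, index_nontrivial X j -> (j <= n)%N].
Proof.
move=> Xm; have [C _] := Tcover_exists X.
have ex : exists j, `[< index_nontrivial X j >] by exists m; apply/asboolP.
have ub j : `[< index_nontrivial X j >] -> (j <= #|{: members C}|)%N.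
  by move/asboolP; exact: index_nontrivial_bounded.
case: (ex_maxnP ex ub) => n /asboolP Xn nmax.
rewrite /yang_index; case: xgetP => [_ -> [j -> [Xj jmax]]|/(_ n%:Z) []].
  by exists j.
by exists n => //; split => // j /asboolP; exact: nmax.
Qed.

End Cech.

Lemma yang_index_mono (X Y : Tspace) :
  (forall m, index_nontrivial X m -> index_nontrivial Y m) ->
  yang_index X <= yang_index Y.
Proof.
move=> XY; have [[m Xm]|X0] := pselect (exists m, index_nontrivial X m).
  have [n [-> /XY Yn _]] := yang_indexP Xm.
  by have [j [-> _ /(_ _ Yn)]] := yang_indexP Yn; rewrite lez_nat.
have -> : yang_index X = -1.
  by rewrite /yang_index; case: xgetP => // e _ [m _ [Xm _]]; case: X0; exists m.
by rewrite /yang_index; case: xgetP => // e _ [m -> _].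
Qed.

(** For a cover [D] of [Y], the preimages form a cover of [X]. Choosing for each preimage a member
    of [D] it comes from, compatibly with the involutions, gives an equivariant map of nerves, which
    carries cycles of index 1 to cycles of index 1. *)
Lemma index_nontrivial_map (X Y : Tspace) (h : X -> Y) m :
  continuous h -> (forall x, h (tinv x) = tinv (h x)) ->
  index_nontrivial X m -> index_nontrivial Y m.
Proof.
move=> hc hT /index_nontrivialP Xm; apply/index_nontrivialP => D.
pose M := [fset (h @^-1` V)%classic | V in members D]%fset.
have MP W : W \in M -> exists2 V, V \in members D & W = h @^-1` V.
  by case/imfsetP => V /= VD ->; exists V.
have MI V : V \in members D -> h @^-1` V \in M by move=> VD; exact: in_imfset.
have Mopen U : U \in M -> open U.
  by move=> /MP[V VD ->]; apply: open_comp => [x _|]; [exact: hc|exact: members_open VD].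
have Mcover x : exists2 U, U \in M & U x.
  by have [V VD Vx] := members_cover D (h x); have hV := MI _ VD; exists (h @^-1` V).
have Mtinv U : U \in M -> @tinv X @` U \in M.
  move=> /MP[V VD ->].
  have -> : @tinv X @` (h @^-1` V) = h @^-1` (@tinv Y @` V).
    by rewrite !tinv_image; apply/funext => x; rewrite /preimage/= hT.
  by apply: MI; exact: members_tinv.
have Mfree U : U \in M -> U `&` @tinv X @` U = set0.
  move=> /MP[V VD ->]; have := members_free VD.
  rewrite !tinv_image -!subset0 => h0 x [Vx]; rewrite /preimage/= hT => Vx'.
  by apply: (h0 (h x)); split.
pose C := MkTcover Mopen Mcover Mtinv Mfree.
have [|f _] := @cover_eqmap X Y h hT C D.
  by move=> _ /MP[V VD ->]; exists V => // _ [x Vx <-].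
have [z zE] := Xm C; exists (push_cycle f z); rewrite /= chain_index_push//.
exact: cycleP.
Qed.

                    

(** * Hemispheres of a sphere as lists of points *)

Lemma bd_chains0 (V : finType) (K : Tcomplex V) (c : chain V) :
  c \in chains K 0 -> bd c = 0.
Proof.
move=> /chainsP cC; apply/ffunP => s; rewrite !ffunE; case: eqP => // /eqP s0.
rewrite big1// => v vs; apply/eqP; apply: contraT => /cC[_].
by rewrite cardsU1 vs add1n => -[/eqP]; rewrite cards_eq0 (negbTE s0).
Qed.

                                                                                
(** Since [c j.+1] is a half of [c j.+1 + T (c j.+1)] and its boundary is [c j + T (c j)], the index
    is the same in all dimensions up to [m]; in dimension 0 it is the parity of [c 0]. *)
Lemma hemispheres_index (V : finType) (K : Tcomplex V) (m : nat) (c : nat -> chain V) :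
  (forall j, (j <= m)%N -> c j \in chains K j) ->
  (forall j, (j < m)%N -> bd (c j.+1) = c j + push (vinv K) (c j)) ->
  \sum_s c 0 s = 1 ->
  exists z : Tcycle K m, chain_index K m z = 1.
Proof.
move=> cC cbd c0.
have cZ j : (j <= m)%N -> bd (c j + push (vinv K) (c j)) = 0.
  case: j => [|j] jm; rewrite bdD bd_push.
    by rewrite (bd_chains0 (cC 0 jm)) raddf0 addr0.
  by rewrite cbd// pushD push_vinvK [_ + c j]addrC chain_addcc.
have czZ : c m + push (vinv K) (c m) \in inv_cycles K m.
  have /inv_chainsP[zC zT] := half_inv_chains (cC m (leqnn m)).
  by apply/inv_cyclesP; split => //; exact: cZ.
exists (TCycle czZ) => /=.
suff ind j : (j <= m)%N -> chain_index K j (c j + push (vinv K) (c j)) = 1 by exact: ind.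
elim: j => [|j IH] jm; rewrite chain_index_half ?cZ ?cC//.
by rewrite cbd// IH// ltnW.
Qed.

(** The rational parametrization ((1 - u^2) / (1 + u^2), 2u / (1 + u^2)) of the circle at u = t / N;
    the parameters from 0 to 1 cover a quarter. *)
Lemma quarter_circle (R : realType) (eps : R) : 0 < eps ->
  exists (N : nat) (a b : nat -> R),
  [/\ a 0 = 1, b 0 = 0, a N = 0, forall t, a t ^+ 2 + b t ^+ 2 = 1 &
   forall t, (t < N)%N -> `|a t.+1 - a t| <= eps /\ `|b t.+1 - b t| <= eps].
Proof.
move=> eps0.
(* Both coordinates are Lipschitz with constant 2 on [0, 1], so steps of length 1 / N with N > 2 /
   eps suffice. *)
pose N := (Num.truncn (2 / eps)).+1.
have N0 : 0 < N%:R :> R by rewrite ltr0n.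
have Neps : 2 / N%:R <= eps.
  rewrite ler_pdivrMr// mulrC -ler_pdivrMr//; apply: ltW.
  by apply: truncnS_gt.
pose A (u : R) := (1 - u ^+ 2) / (1 + u ^+ 2); pose B (u : R) := (2 * u) / (1 + u ^+ 2).
have pos (u : R) : 0 < 1 + u ^+ 2 by rewrite ltr_pwDl// sqr_ge0.
have lip (u v : R) : 0 <= u <= 1 -> 0 <= v <= 1 ->
    `|A v - A u| <= 2 * `|v - u| /\ `|B v - B u| <= 2 * `|v - u|.
  move=> /andP[u0 u1] /andP[v0 v1].
  have D0 : 0 < (1 + v ^+ 2) * (1 + u ^+ 2) by rewrite mulr_gt0.
  have Nu : 1 + u ^+ 2 != 0 by rewrite gt_eqF.
  have Nv : 1 + v ^+ 2 != 0 by rewrite gt_eqF.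
  have bnd x : `|x| <= 2 * ((1 + v ^+ 2) * (1 + u ^+ 2)) ->
      `|(v - u) * x / ((1 + v ^+ 2) * (1 + u ^+ 2))| <= 2 * `|v - u|.
    move=> xD; rewrite !normrM normfV (gtr0_norm D0) ler_pdivrMr//.
    by rewrite mulrAC [X in _ <= X]mulrC ler_wpM2l ?normr_ge0.
  have uv0 : 0 <= u * v by rewrite mulr_ge0.
  have uv1 : u * v <= 1 by rewrite mulr_ile1.
  have u2 := sqr_ge0 u; have v2 := sqr_ge0 v; have u2v2 := mulr_ge0 u2 v2.
  have u12 := sqr_ge0 (u - 1); have v12 := sqr_ge0 (v - 1).
  rewrite (_ : A v - A u = (v - u) * (- 2 * (u + v)) / ((1 + v ^+ 2) * (1 + u ^+ 2))); last first.
    by rewrite /A; field; rewrite Nu Nv.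
  rewrite (_ : B v - B u = (v - u) * (2 * (1 - u * v)) / ((1 + v ^+ 2) * (1 + u ^+ 2))); last first.
    by rewrite /B; field; rewrite Nu Nv.
  split; apply: bnd; rewrite ler_norml; apply/andP; split; nra.
exists N, (fun t => A (t%:R / N%:R)), (fun t => B (t%:R / N%:R)); split.
- by rewrite /A mul0r expr0n/= subr0 addr0 divr1.
- by rewrite /B mul0r mulr0 mul0r.
- by rewrite /A divff ?gt_eqF// expr1n subrr mul0r.
- move=> t; rewrite /A /B; set u := t%:R / N%:R.
  by field; rewrite gt_eqF.
move=> t tN.
have bnd (s : nat) : (s <= N)%N -> 0 <= (s%:R / N%:R : R) <= 1.
  by move=> sN; rewrite divr_ge0//= ler_pdivrMr// mul1r ler_nat.
have [Al Bl] := lip _ _ (bnd t (ltnW tN)) (bnd t.+1 tN).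
have dE : 2 * `|t.+1%:R / N%:R - t%:R / N%:R| = 2 / N%:R :> R.
  by rewrite -mulrBl -natrB// subSnn mul1r ger0_norm// invr_ge0.
by rewrite dE in Al Bl; split; apply: le_trans Neps.
Qed.

Section Hemispheres.
Variables (R : realType) (n k : nat).
Local Notation point := 'cV[R]_n.

Definition basis_vec (j : nat) : point := \col_i (i.+1 == k + j)%N%:R.

Variables (N : nat) (a b : nat -> R).

(** Moves [y] along the quarter circle towards the pole e_(k+j), coordinates being counted from 1.
    With the boundary values assumed below, it is the identity at t = 0 and no longer depends on [y]
    at t = N. *)
Definition rotate (j t : nat) (y : point) : point := a t *: y + b t *: basis_vec j.

(** The equatorial sphere, made of the previous hemisphere and its antipode, is rotated to the pole
    in N steps; [prism] cuts the layer between consecutive steps into simplices. *)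
Fixpoint hemisphere (j : nat) : seq (seq point) :=
  if j is j'.+1 then
    flatten [seq flatten [seq prism (rotate j t) (rotate j t.+1) l |
      l <- hemisphere j' ++ map (map -%R) (hemisphere j')] | t <- index_iota 0 N]
  else [:: [:: basis_vec 0]].

Hypotheses (a0 : a 0 = 1) (b0 : b 0 = 0) (aN : a N = 0).

Lemma sum_hemisphere j (phi : seq point -> 'F_2) :
  \sum_(u <- hemisphere j.+1) phi u =
  \sum_(0 <= t < N) (\sum_(l <- hemisphere j)
    (\sum_(u <- prism (rotate j.+1 t) (rotate j.+1 t.+1) l) phi u +
     \sum_(u <- prism (rotate j.+1 t) (rotate j.+1 t.+1) (map -%R l)) phi u)).
Proof.
rewrite /= big_flatten big_map; apply: eq_bigr => t _.
by rewrite big_flatten big_map big_cat big_map big_split.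
Qed.

Lemma map_opprK (l : seq point) : map -%R (map -%R l) = l.
Proof. by rewrite -map_comp -[RHS]map_id; apply: eq_map => y /=; exact: opprK. Qed.

                                                                             
                                                                           
(** The boundary of a hemisphere is its equator. Each layer contributes its bottom and its top, plus
    prisms over the boundary of the equatorial sphere, which vanish because that sphere is a cycle.
    The layers telescope from the equator at t = 0 to the pole at t = N. *)
Lemma faces_hemisphere j (phi : seq point -> 'F_2) :
  \sum_(u <- hemisphere j.+1) \sum_(v <- faces u) phi v =
  \sum_(l <- hemisphere j) (phi l + phi (map -%R l)).
Proof.
(* Once the boundary of a hemisphere is known to be antipodally invariant, the hemisphere and its
   antipode add up to a cycle, the input of the next sweep. *)
have sphere_cycle i (psi : seq point -> 'F_2) : (forall phi : seq point -> 'F_2,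
      \sum_(u <- hemisphere i.+1) \sum_(v <- faces u) phi v =
      \sum_(l <- hemisphere i) (phi l + phi (map -%R l))) ->
    \sum_(l <- hemisphere i.+1) (\sum_(u <- faces l) psi u + \sum_(u <- faces l) psi (map -%R u)) = 0.
  move=> E; rewrite big_split (E psi) (E (fun u => psi (map -%R u))) -big_split big1// => l _.
  by rewrite /= map_opprK [X in _ + X]addrC F2_addrr.
have add2 (x1 x2 y1 y2 p1 p2 q1 q2 : 'F_2) : x1 + y1 = p1 + q1 -> x2 + y2 = p2 + q2 ->
    x1 + x2 = (q1 + q2) + (p1 + p2) + (y1 + y2).
  move=> E1 E2; have -> : q1 + q2 + (p1 + p2) + (y1 + y2) = (p1 + q1) + (p2 + q2) + (y1 + y2) by ring.
  rewrite -E1 -E2; have -> : x1 + y1 + (x2 + y2) + (y1 + y2) = x1 + x2 + ((y1 + y1) + (y2 + y2)) by ring.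
  by rewrite !F2_addrr !addr0.
suff sweep i : (forall psi : seq point -> 'F_2, \sum_(l <- hemisphere i)
      (\sum_(u <- faces l) psi u + \sum_(u <- faces l) psi (map -%R u)) = 0) ->
    forall phi : seq point -> 'F_2, \sum_(u <- hemisphere i.+1) \sum_(v <- faces u) phi v =
      \sum_(l <- hemisphere i) (phi l + phi (map -%R l)).
  elim: j phi => [|j IH] phi; apply: sweep => psi; last exact: sphere_cycle.
  by rewrite big_seq1 !big_seq1 F2_addrr.
move=> {j phi} icyc phi; rewrite sum_hemisphere.
pose H t := \sum_(l <- hemisphere i) (phi (map (rotate i.+1 t) l) +
  phi (map (rotate i.+1 t) (map -%R l))).
rewrite (@telescope_sumr_eq _ _ _ H)//; last first.
  move=> t _; rewrite -[RHS]addr0 F2_oppr.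
  rewrite -[X in _ = _ + X](icyc (fun u => \sum_(v <- prism (rotate i.+1 t) (rotate i.+1 t.+1) u) phi v)).
  rewrite /H -!big_split/=; apply: eq_bigr => l _.
  have P q := faces_prism (rotate i.+1 t) (rotate i.+1 t.+1) q phi.
  by have := P (map -%R l); rewrite faces_map big_map; apply: add2; exact: P.
have H0 : H 0 = \sum_(l <- hemisphere i) (phi l + phi (map -%R l)).
  apply: eq_bigr => l _.
  have id0 : rotate i.+1 0 =1 id by move=> y; rewrite /rotate a0 b0 scale1r scale0r addr0.
  by rewrite !(eq_map id0) !map_id.
(* At the pole [l] and its antipode become the same list, so their contributions cancel. *)
rewrite [H N]big1 ?sub0r ?F2_oppr// => l _.
rewrite -[map _ (map _ _)]map_comp (@eq_map _ _ (_ \o _) (rotate i.+1 N)) ?F2_addrr// => y.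
by rewrite /rotate /= aN !scale0r.
Qed.

(** The unit sphere of dimension j in the span of e_k, ..., e_(k+j). *)
Definition on_sphere (j : nat) (y : point) : Prop :=
  \sum_i y i 0 ^+ 2 = 1 /\ forall i : 'I_n, y i 0 != 0 -> (k <= i.+1 <= k + j)%N.

Lemma on_sphereN j y : on_sphere j y -> on_sphere j (- y).
Proof.
move=> [y1 yj]; split=> [|i]; last by rewrite mxE oppr_eq0; exact: yj.
by rewrite -y1; apply: eq_bigr => i _; rewrite mxE sqrrN.
Qed.

Lemma on_sphere_le1 j y (i : 'I_n) : on_sphere j y -> `|y i 0| <= 1.
Proof.
move=> [y1 _]; rewrite -(@expr_le1 _ 2)// -normrX ger0_norm ?sqr_ge0// -y1.
by rewrite (bigD1 i)//= lerDl sumr_ge0// => l _; exact: sqr_ge0.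
Qed.

Hypothesis k_gt0 : (0 < k)%N.

Lemma on_sphere_basis j : (k + j <= n)%N -> on_sphere j (basis_vec j).
Proof.
move=> kj; have lt : ((k + j).-1 < n)%N by rewrite prednK// addn_gt0 k_gt0.
split=> [|i]; last first.
  by rewrite mxE; case: (i.+1 =P (k + j)%N) => [->|]; rewrite ?eqxx// leq_addr leqnn.
rewrite (bigD1 (Ordinal lt))//= mxE/= prednK ?addn_gt0 ?k_gt0// eqxx expr1n big1 ?addr0// => i ij.
rewrite mxE; case: eqP => [E|]; last by rewrite expr0n.
by case/eqP: ij; apply: val_inj; rewrite /= -E.
Qed.

Hypothesis ab1 : forall t, a t ^+ 2 + b t ^+ 2 = 1.

Lemma on_sphere_rotate j t y : (k + j.+1 <= n)%N ->
  on_sphere j y -> on_sphere j.+1 (rotate j.+1 t y).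
Proof.
move=> kj [y1 yj]; have [e1 ej] := on_sphere_basis kj; split=> [|i].
  rewrite -(ab1 t) -[X in X + _]mulr1 -[X in _ + X]mulr1 -{1}y1 -e1 !mulr_sumr -big_split/=.
  apply: eq_bigr => i _; rewrite !mxE; case: eqP => iE; last by rewrite /= mulr0n; ring.
  have -> : y i 0 = 0.
    by apply/eqP; apply: contraT => /yj; rewrite iE addnS ltnn andbF.
  by rewrite /= mulr1n; ring.
have [iE|iE] := eqVneq (i.+1) (k + j.+1)%N; first by rewrite iE leq_addr leqnn.
rewrite !mxE (negbTE iE) mulr0 addr0 mulf_eq0 negb_or.
by move=> /andP[_ /yj/andP[-> ij]]; rewrite (leq_trans ij)// leq_add2l.
Qed.

Variable eps : R.
Hypothesis ab_eps : forall t, (t < N)%N ->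
  `|a t.+1 - a t| <= eps /\ `|b t.+1 - b t| <= eps.

(** The coefficient [a s] and the coordinates are at most 1 in absolute value, so the distance [d]
    is not enlarged, and the changes of [a] and of [b] cost [eps] each. *)
Lemma rotate_dist j t s s' (y y' : point) d : (t < N)%N -> on_sphere j y -> on_sphere j y' ->
  s \in [:: t; t.+1] -> s' \in [:: t; t.+1] ->
  (forall i, `|y i 0 - y' i 0| <= d) ->
  forall i, `|rotate j.+1 s y i 0 - rotate j.+1 s' y' i 0| <= d + eps + eps.
Proof.
move=> tN yS y'S st s't dy i; have [aE bE] := ab_eps tN.
have eps0 : 0 <= eps by exact: le_trans aE.
have close (c : nat -> R) : `|c t.+1 - c t| <= eps -> `|c s - c s'| <= eps.
  move=> cE; move: st s't; rewrite !inE => /orP[]/eqP-> /orP[]/eqP->;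
  by rewrite ?subrr ?normr0// distrC.
have a1 : `|a s| <= 1.
  by rewrite -(@expr_le1 _ 2)// -normrX ger0_norm ?sqr_ge0// -(ab1 s) lerDl sqr_ge0.
rewrite !mxE.
have -> : a s * y i 0 + b s * (i.+1 == k + j.+1)%N%:R -
    (a s' * y' i 0 + b s' * (i.+1 == k + j.+1)%N%:R) =
  a s * (y i 0 - y' i 0) + (a s - a s') * y' i 0 + (b s - b s') * (i.+1 == k + j.+1)%N%:R.
  by ring.
apply: le_trans (ler_normD _ _) _; apply: lerD.
  apply: le_trans (ler_normD _ _) _; rewrite !normrM; apply: lerD.
    by apply: le_trans (dy i); rewrite ler_piMl.
  by apply: le_trans (close a aE); rewrite ler_piMr// (on_sphere_le1 _ y'S).
rewrite normrM; apply: le_trans (close b bE); rewrite ler_piMr//.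
by case: eqP; rewrite ?normr1 ?normr0.
Qed.

(** Each of the j sweeps adds at most [2 * eps] to the coordinatewise diameter of a list. *)
Lemma hemisphereP j l : (k + j <= n)%N -> l \in hemisphere j ->
  [/\ size l = j.+1, {in l, forall y, on_sphere j y} &
   {in l &, forall (y y' : point), forall i, `|y i 0 - y' i 0| <= (2 * j)%:R * eps}].
Proof.
elim: j l => [|j IH] l kj.
  rewrite inE => /eqP->; split => // [y|y y']; rewrite !inE => /eqP->.
    exact: on_sphere_basis.
  by move=> /eqP-> i; rewrite subrr normr0 muln0 mulr0n mul0r.
have kj' : (k + j <= n)%N by apply: leq_trans kj; rewrite leq_add2l.
have {}IH l' : l' \in hemisphere j ++ map (map -%R) (hemisphere j) ->
  [/\ size l' = j.+1, {in l', forall y, on_sphere j y} &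
   {in l' &, forall (y y' : point), forall i, `|y i 0 - y' i 0| <= (2 * j)%:R * eps}].
  rewrite mem_cat => /orP[/(IH _ kj')//|/mapP[u /(IH _ kj')[su uS ud] ->]].
  split; first by rewrite size_map.
    by move=> _ /mapP[y yu ->]; apply: on_sphereN; exact: uS.
  move=> _ _ /mapP[y yu ->] /mapP[y' y'u ->] i.
  by rewrite !mxE -opprD normrN; exact: ud.
move=> /flattenP[ll /mapP[t]]; rewrite mem_index_iota => /andP[_ tN] ->.
move=> /flattenP[_ /mapP[l' /IH[sl' l'S l'd] ->] ll'].
have rot y : y \in l -> exists2 y', y' \in l' & exists2 s, s \in [:: t; t.+1] & y = rotate j.+1 s y'.
  move=> /(mem_prism ll')[y' y'l /orP[]/eqP->]; exists y' => //.
    by exists t => //; rewrite inE eqxx.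
  by exists t.+1 => //; rewrite !inE eqxx orbT.
split; first by rewrite (size_prism ll') sl'.
  by move=> _ /rot[y yl [s _ ->]]; apply: on_sphere_rotate => //; exact: l'S.
move=> _ _ /rot[y yl [s st ->]] /rot[y' y'l [s' s't ->]] i.
have -> : (2 * j.+1)%:R * eps = (2 * j)%:R * eps + eps + eps :> R by rewrite mulnS natrD; ring.
apply: rotate_dist tN _ _ st s't _ i; [exact: l'S|exact: l'S|].
by move=> i; apply: l'd.
Qed.

End Hemispheres.

                                     

(** * The sphere of dimension n - k inside the Stiefel manifold *)

Section StiefelIndex.
Variables (R : realType) (n k : nat).
Hypotheses (k_gt0 : (0 < k)%N).
Local Notation St := (Stiefel_Tspace R n k_gt0).
Local Notation point := 'cV[R]_n.

(** The frame (e_1, ..., e_(k-1), y). It is orthonormal for [y] on the sphere, whose points have no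
    coordinate before the k-th. *)
Definition frame (y : point) : 'M[R]_(n, k) :=
  \matrix_(i, j) if j.+1 == k then y i 0 else (i == j :> nat)%:R.

Lemma frameN y : frame (- y) = neg_last (frame y).
Proof. by apply/matrixP => i j; rewrite !mxE; case: ifP. Qed.

Lemma frameP j y : (k <= n)%N -> on_sphere k j y -> frames (frame y).
Proof.
move=> kn [y1 yj]; apply/matrixP => p q; rewrite !mxE.
under eq_bigr do rewrite !mxE.
have ord_k (r : 'I_k) : r.+1 != k -> (r.+1 < k)%N by rewrite ltn_neqAle ltn_ord andbT.
have y0 (r : 'I_k) (i : 'I_n) : r.+1 != k -> i = r :> nat -> y i 0 = 0.
  move=> /ord_k rk ir; apply/eqP; apply: contraT => /yj/andP[+ _].
  by rewrite ir leqNgt rk.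
have [pk|pk] := eqVneq p.+1 k; have [qk|qk] := eqVneq q.+1 k.
- have -> : p = q by apply: val_inj; apply: succn_inj; rewrite pk qk.
  by rewrite eqxx -y1; apply: eq_bigr => i _; rewrite expr2.
- have -> : (p == q) = false by apply: contraNF qk => /eqP <-; apply/eqP.
  rewrite big1// => i _; case: eqP => iq; last by rewrite mulr0.
  by rewrite (y0 q) ?mul0r.
- have -> : (p == q) = false by apply: contraNF pk => /eqP ->; apply/eqP.
  rewrite big1// => i _; case: eqP => ip; last by rewrite mul0r.
  by rewrite (y0 p) ?mulr0.
have pn : (p < n)%N by apply: leq_trans kn.
rewrite (bigD1 (Ordinal pn))//= eqxx mul1r big1 ?addr0// => i ip.
case: eqP => [E|_]; last by rewrite mul0r.
by case/eqP: ip; apply: val_inj.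
Qed.

Definition frame_point (v : 'M[R]_(n, k)) (fv : frames v) : Stiefel R n k :=
  exist _ v (mem_set fv).

(** A Lebesgue number for the entrywise distance, again by compactness in near-covering form. Around
    [v] one works with half the radius of a ball inside a member, leaving the other half for the
    ball around a nearby point. *)
Lemma lebesgue_number (C : Tcover St) : exists2 d : R, 0 < d &
  forall v : St, exists2 U, U \in members C &
    forall w : St, (forall i j, `|val v i j - val w i j| < d) -> U w.
Proof.
pose P (d : R) (v : St) := exists2 U, U \in members C &
  forall w : St, (forall i j, `|val v i j - val w i j| < d) -> U w.
have near_v (v : St) : \forall x \near v & d \near (0 : R)^'+, P d x.
  have [U UC Uv] := members_cover C v.
  have [D oD DU] := members_open UC.
  have Dv : D (val v) by have : U v by []; rewrite -DU.
  have /nbhs_ballP[r /= r0 rD] : nbhs (val v) D by exact: open_nbhs_nbhs.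
  have r20 : 0 < r / 2 by rewrite divr_gt0.
  exists (val @^-1` ball (val v) (r / 2), [set d | 0 < d <= r / 2]); first split => /=.
  - apply: (@Defs.val_Stiefel_continuous R n k v); exact: nbhsx_ballx.
  - near=> d; apply/andP; split; first by near: d; exact: nbhs_right_gt.
    by near: d; apply: nbhs_right_le.
  case=> x d [/= xv /andP[d0 dr]]; exists U => // w xw.
  suff : D (val w) by rewrite -DU.
  apply: rD; split=> // i j; rewrite /ball/=.
  have vx : `|val v i j - val x i j| < r / 2 by case: xv => _; apply.
  have -> : val v i j - val w i j = (val v i j - val x i j) + (val x i j - val w i j) by ring.
  apply: le_lt_trans (ler_normD _ _) _.
  by rewrite [r]splitr ltrD// (lt_le_trans (xw i j)).
have near_d : \forall d \near (0 : R)^'+, [set: St] `<=` P d.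
  by apply: (iffLR (compact_near_coveringP [set: St]) (@Tspace_compact St)) => v _.
have [d [dP d0]] : exists d, ([set: St] `<=` P d) /\ 0 < d.
  by apply: (@filter_ex _ (0 : R)^'+); apply: filterI near_d _; exact: nbhs_right_gt.
by exists d => // v; exact: dP.
Unshelve. all: by end_near.
Qed.

(** The labelling is an equivariant choice for y -> -y, whose only fixed point is 0. Points that do
    not give a frame carry no constraint and may be labelled by any member. *)
Lemma sphere_labels (C : Tcover St) : (k <= n)%N -> exists2 d : R, 0 < d &
  exists f : point -> members C,
  (forall y (w : St), frames (frame y) ->
     (forall i j, `|frame y i j - val w i j| < d) -> val (f y) w) /\
  (forall y, y != 0 -> f (- y) = nerve_vinv (f y)).
Proof.
move=> kn; have [d d0 dP] := lebesgue_number C; exists d => //.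
pose E (y : point) (U : members C) := frames (frame y) ->
  forall w : St, (forall i j, `|frame y i j - val w i j| < d) -> val U w.
have EN y U : E y U -> E (- y) (nerve_vinv U).
  move=> yU; rewrite /E frameN => fy w yw; exists (tinv w); last exact: tinvK.
  apply: yU => [|i j]; first by rewrite -[frame y]neg_lastK; exact: neg_last_frames.
  have := yw i j; rewrite /= [neg_last (frame y) i j]mxE [neg_last (val w) i j]mxE.
  by case: ifP => // _; rewrite -normrN opprD !opprK.
have fbase : frames (frame (basis_vec R n k 0)).
  by apply: (@frameP 0) => //; apply: on_sphere_basis; rewrite ?addn0.
have [U0 U0C _] := dP (frame_point fbase).
have Eex y : exists U, E y U.
  have [fy|nfy] := pselect (frames (frame y)); last by exists (FSetSub U0C).
  have [U UC UP] := dP (frame_point fy).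
  by exists (FSetSub UC) => _ w yw; exact: UP.
have [f [fE fN]] := equivariant_choice (@opprK point) EN (@nerve_vinvK _ C) Eex.
exists f; split=> [y w fy|y y0]; first exact: fE.
apply: fN => yy; case/eqP: y0; apply/matrixP => i j.
have := congr1 (fun M : point => M i j) yy; rewrite !mxE => yE; lra.
Qed.

(** The hemispheres are pushed to the nerve by the labelling [f]; their boundary relation survives
    because [bd_simplex] is also valid for degenerate lists of labels. *)
Lemma Stiefel_index_nontrivial : (k <= n)%N -> index_nontrivial St (n - k).
Proof.
move=> kn; apply/index_nontrivialP => C.
have [d d0 [f [fU fN]]] := sphere_labels C kn.
(* Chosen so that the diameter bound [2 * j * eps] of the lists stays below [d] for all j <= n. *)
pose eps := d / (2 * n).+1%:R.
have eps0 : 0 < eps by rewrite divr_gt0.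
have epsd j : (j <= n)%N -> (2 * j)%:R * eps < d.
  move=> jn; rewrite /eps mulrA ltr_pdivrMr// [X in X < _]mulrC ltr_pM2l// ltr_nat.
  by rewrite ltnS leq_mul2l jn.
have [N [a [b [a0 b0 aN ab1 ab_eps]]]] := quarter_circle eps0.
pose H j := @hemisphere R n k N a b j.
have HP j l (kj : (k + j <= n)%N) := hemisphereP k_gt0 ab1 ab_eps kj (l := l).
have Hn j : (j <= n - k)%N -> (k + j <= n)%N by rewrite -{2}(subnKC kn) leq_add2l.
pose c j : chain (members C) := \sum_(l <- H j) simplex (map f l).
have cT j : (j <= n - k)%N ->
    push (vinv (nerve C)) (c j) = \sum_(l <- H j) simplex (map f (map -%R l)).
  move=> /Hn jn; rewrite raddf_sum big_seq [RHS]big_seq; apply: eq_bigr => l /(HP _ _ jn)[_ lS _].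
  rewrite /= push_simplex; congr simplex; rewrite -!map_comp; apply/eq_in_map => y /lS[y1 _] /=.
  rewrite fN//; apply: contraTneq isT => y0; move/eqP: y1.
  by rewrite big1 ?(eq_sym 0) ?oner_eq0// => i _; rewrite y0 mxE expr0n.
have bdE j s : bd (c j) s = \sum_(l <- H j) \sum_(u <- faces l) simplex (map f u) s.
  rewrite /c raddf_sum sum_ffunE; apply: eq_bigr => l _.
  by rewrite -[LHS]/(bd (simplex (map f l)) s) bd_simplex faces_map big_map.
apply: (@hemispheres_index _ (nerve C) _ c).
- move=> j /Hn jn; apply/chainsP => s; rewrite sum_ffunE => s0.
  have [l lH /simplexP[l0 sE sl]] : exists2 l, l \in H j & simplex (map f l) s != 0.
    apply/hasP; apply: contraNT s0 => /hasPn h.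
    by rewrite big1_seq// => l /= /h; rewrite negbK => /eqP.
  have [lj lS ld] := HP _ _ jn lH.
  rewrite sl size_map lj; split => //; apply/nerveP; split.
    by rewrite -cards_eq0 sl size_eq0.
  have [y0 y0l] : exists y, y \in l by case: (l) l0 => // y u _; exists y; rewrite mem_head.
  (* The frame of a single point of the list lies within [d] of the frames of all the others, hence
     in all their labels. *)
  exists (frame_point (frameP kn (lS _ y0l))) => U.
  rewrite sE inE => /mapP[y yl ->]; apply: fU; first exact: frameP (lS _ yl).
  move=> p q; rewrite /= !mxE; case: ifP => _; last by rewrite subrr normr0.
  apply: le_lt_trans (epsd j _); first exact: ld.
  by apply: leq_trans jn; exact: leq_addl.
- move=> j jn; rewrite cT; last exact: ltnW.
  apply/ffunP => s; rewrite bdE.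
  rewrite (faces_hemisphere k a0 b0 aN j (fun l => simplex (map f l) s)).
  by rewrite [RHS]ffunE /c !sum_ffunE -big_split.
rewrite /c big_seq1 (bigD1 [set f (basis_vec R n k 0)]%SET)//= big1.
  rewrite addr0 ffunE /= cards1 eqxx andbT; case: eqP => // E; case: E.
  by apply/setP => U; rewrite !inE.
move=> s /negbTE s1; rewrite ffunE /= (_ : [set x in _]%SET = [set f (basis_vec R n k 0)]%SET) ?s1//.
by apply/setP => U; rewrite !inE.
Qed.

End StiefelIndex.

Theorem theorem1p1 (R : realType) (n k : nat)
    (k_ge1 : (1 <= k)%N) (k_le_n : (k <= n)%N) :
  n%:Z - k%:Z <= yang_index (Stiefel_Tspace R n k_ge1)
              <= yang_index (Grassmannian_Tspace R n k_ge1).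
Proof.
apply/andP; split.
  have nt := Stiefel_index_nontrivial R k_ge1 k_le_n.
  have [m [-> _ /(_ _ nt)]] := yang_indexP nt.
  by rewrite subzn// lez_nat.
apply: yang_index_mono => m.
apply: (@index_nontrivial_map (Stiefel_Tspace R n k_ge1) (Grassmannian_Tspace R n k_ge1)
  (\pi_(Grassmannian R n k))) => [v|v].
  exact: pi_continuous.
exact/esym/Grassmannian_inv_pi.
Qed.
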